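(* Let $p$ be an odd prime, $k$ a finite field of characteristic $p$, and let $D=\{x_1,\dots,x_m\}$ ($m\ge4$) be marked points on $\mathbb P^1$ over $W(k)$, distinct modulo $p$. Let $M(1,0)$ be the moduli space over $k$ of graded logarithmic Higgs bundles on $(\mathbb P^1_k,D)$ of the form $(\mathcal O(1)\oplus\mathcal O,\theta)$ with nonzero $\theta:\mathcal O(1)\to\mathcal O\otimes\Omega^1_{\mathbb P^1}(\log D)$. Then the rational self-map $\varphi:M(1,0)\dashrightarrow M(1,0)$ induced by the Higgs-de Rham flow (see context) is dominant.
   Context: Two such Higgs bundles are isomorphic iff the Higgs fields differ by a scalar, so $M(1,0)\cong\mathbb P(H^0(\mathbb P^1,\mathcal O(m-3)))\cong\mathbb P^{m-3}$. It is a component of the moduli space of semistable graded logarithmic Higgs bundles of rank 2 and degree 1 on $(\mathbb P^1_k,D)$. The logarithmic inverse Cartier transform $C_1^{-1}$ (for the $W_2(k)$-lifting $(\mathbb P^1,D)$): for a nilpotent logarithmic Higgs bundle $(E,\theta)$, on affine opens $U_i$ with Frobenius liftings $\Phi_i$ to $W_2(k)$ satisfying $\Phi_i^*D=pD$, take $F^*(E|_{U_i})$ ($F$ the absolute Frobenius) with connection $\nabla_{\mathrm{can}}+\frac{\mathrm d\Phi_i}p(F^*\theta)$, glued by $\exp(h_{ij}(F^*\theta))$ with $h_{ij}(F^*\mathrm dt)=\frac{\Phi_i(t)-\Phi_j(t)}p$. For $(E,\theta)\in M(1,0)$ the bundle $V$ underlying $(V,\nabla)=C_1^{-1}(E,\theta)$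 has rank 2 and degree $p$. On a dense open subset $U\subset M(1,0)$ one has $V\cong\mathcal O(\frac{p-1}2)\oplus\mathcal O(\frac{p+1}2)$; the filtration $0\subset\mathcal O(\frac{p+1}2)\subset V$ is not $\nabla$-invariant, and $\varphi(E,\theta)=\mathrm{Gr}(V,\nabla)\otimes\mathcal O(\frac{1-p}2)\in M(1,0)$, where $\mathrm{Gr}(V,\nabla)=V/\mathcal O(\frac{p+1}2)\oplus\mathcal O(\frac{p+1}2)$ with Higgs field induced by $\nabla$. This defines the rational map $\varphi$. *)

(* Defs.v *)
From HB Require Import structures.
From mathcomp Require Import all_boot all_order all_algebra generic_quotient.
From mathcomp Require Import mpoly.

Set Implicit Arguments.
Unset Strict Implicit.
Unset Printing Implicit Defensive.

Import GRing.Theory.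
Local Open Scope ring_scope.

Definition eq_mod (W : comNzRingType) (p n : nat) (x y : W) : Prop :=
  exists z : W, x - y = p%:R ^+ n * z.

(* W(k) for a perfect field k of characteristic p, i.e. the strict p-ring with
   residue ring k (unique up to unique isomorphism): W is p-torsion free,
   p-adically separated and complete, and red : W -> k is onto with kernel
   pW.  sigma is the Witt vector Frobenius, i.e. the lift of x |-> x^p. *)
Record is_witt_ring (p : nat) (k : fieldType) (W : comNzRingType)
    (red : {rmorphism W -> k}) (sigma : {rmorphism W -> W}) : Prop := {
  witt_surj : forall y : k, exists x : W, red x = y;
  witt_ker : forall x : W, red x = 0 <-> eq_mod p 1 x 0;
  witt_torsionfree : forall x : W, p%:R * x = 0 -> x = 0;
  witt_separated : forall x : W, (forall n, eq_mod p n x 0) -> x = 0;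
  witt_complete : forall u : nat -> W,
    (forall n, eq_mod p n (u n.+1) (u n)) ->
    exists l : W, forall n, eq_mod p n l (u n);
  witt_frob : forall x : W, red (sigma x) = red x ^+ p
}.

(* Homogeneous coordinates (a, b) of a W-point [a : b]; it is the point
   t = a / b of the chart U_0 = Spec W[t], and u = b / a of the chart
   U_oo = Spec W[u], where u = 1 / t. *)
Definition is_point (W : comNzRingType) (x : W * W) : Prop :=
  exists c d : W, c * x.1 + d * x.2 = 1.

Definition distinct_mod_p (k : fieldType) (W : comNzRingType)
    (red : {rmorphism W -> k}) (m : nat) (x : 'I_m -> W * W) : Prop :=
  forall i j : 'I_m, i != j ->
    red (x i).1 * red (x j).2 != red (x j).1 * red (x i).2.

(* Equations of the divisor D = x_1 + ... + x_m on U_0 (a polynomial in t)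
   and on U_oo (a polynomial in u).  A point at t = oo contributes a unit to
   the first one, a point at t = 0 a unit to the second one. *)
Definition div0 (R : comNzRingType) (m : nat) (x : 'I_m -> R * R) : {poly R} :=
  \prod_(i < m) ((x i).2 *: 'X - (x i).1%:P).

Definition divoo (R : comNzRingType) (m : nat) (x : 'I_m -> R * R) : {poly R} :=
  \prod_(i < m) ((x i).2%:P - (x i).1 *: 'X).

Definition map_point (R S : comNzRingType) (f : R -> S) (m : nat)
    (x : 'I_m -> R * R) : 'I_m -> S * S :=
  fun i => (f (x i).1, f (x i).2).

(* Congruence modulo p^2 in W[T], i.e. equality in W_2(k)[T]. *)
Definition eq_W2 (p : nat) (W : comNzRingType) (f g : {poly W}) : Prop :=
  exists h : {poly W}, f - g = (p%:R ^+ 2) *: h.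

(* Every sigma-semilinear lifting to W_2(k)[T] of the Frobenius of k[T] is
   T |-> Phi(T) with Phi = T^p + p c; then c mod p is (Phi(T) - T^p) / p. *)
Definition frob_lift (p : nat) (W : comNzRingType) (c : {poly W}) : {poly W} :=
  'X^p + p%:R *: c.

(* Phi^* D = p D over W_2(k), for D with equation P: the pull-back
   P^sigma(Phi) of P is a unit of W_2(k)[T] times P^p. *)
Definition log_frob_lift (p : nat) (W : comNzRingType)
    (sigma : {rmorphism W -> W}) (P c : {poly W}) : Prop :=
  exists u v : {poly W},
    eq_W2 p (u * v) 1 /\
    eq_W2 p (map_poly sigma P \Po frob_lift p c) (u * P ^+ p).

Notation ratfun K := {fraction {poly K}}.

Definition of_poly (K : fieldType) (f : {poly K}) : ratfun K :=
  @FracField.tofrac {poly K} f.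

Definition tvar (K : fieldType) : ratfun K := of_poly 'X.

(* f(u) with u = 1 / t. *)
Definition of_poly_inv (K : fieldType) (f : {poly K}) : ratfun K :=
  (map_poly (fun c : K => of_poly c%:P) f).[(tvar K)^-1].

Definition reg0 (K : fieldType) (f : ratfun K) : Prop :=
  exists q : {poly K}, f = of_poly q.

Definition regoo (K : fieldType) (f : ratfun K) : Prop :=
  exists q : {poly K}, f = of_poly_inv q.

Definition reg0oo (K : fieldType) (f : ratfun K) : Prop :=
  exists (q : {poly K}) (n : nat), f = of_poly q / tvar K ^+ n.

(* d/dt, by the quotient rule. *)
Definition ddt (K : fieldType) (f : ratfun K) : ratfun K :=
  let n := (frac (repr f)).1 in
  let d := (frac (repr f)).2 in
  of_poly (n^`() * d - n * d^`()) / of_poly (d ^+ 2).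

Definition mx_in (K : fieldType) (O : ratfun K -> Prop) (r : nat)
    (A : 'M[ratfun K]_r) : Prop :=
  forall i j, O (A i j).

Definition GL_in (K : fieldType) (O : ratfun K -> Prop) (r : nat)
    (A : 'M[ratfun K]_r) : Prop :=
  [/\ A \in unitmx, mx_in O A & mx_in O (invmx A)].

(* A rank r vector bundle on P^1 is given by its transition matrix
   g in GL_r(K[t, 1/t]): it has frames e_0 on U_0 and e_oo on U_oo, and
   e_0 v_0 = e_oo v_oo iff v_oo = g v_0.  Higgs fields and connection matrices
   are those in the frame e_0, with dt as a generator of the 1-forms: they
   stand for theta (e_0 v) = e_0 (A v) dt and nabla (e_0 v) = e_0 (v' + A v) dt.
   In the frame e_oo a Higgs field becomes g A g^-1, and a connection matrix
   becomes g A g^-1 - g' g^-1. *)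
Record higgs (K : fieldType) (r : nat) := Higgs {
  htrans : 'M[ratfun K]_r;
  hfield : 'M[ratfun K]_r
}.

Record conn (K : fieldType) (r : nat) := Conn {
  ctrans : 'M[ratfun K]_r;
  cmatrix : 'M[ratfun K]_r
}.

Definition is_bundle (K : fieldType) (r : nat) (g : 'M[ratfun K]_r) : Prop :=
  GL_in (@reg0oo K) g.

(* O(d_1) + ... + O(d_r); O(d) has transition function t^-d. *)
Definition split_bundle (K : fieldType) (r : nat) (d : 'I_r -> int) :
    'M[ratfun K]_r :=
  diag_mx (\row_j (tvar K ^ (- d j))).

(* f dt is a section of Omega^1(log D) over U_0, resp. over U_oo, where
   dt = - t^2 du. *)
Definition log_form0 (K : fieldType) (m : nat) (x : 'I_m -> K * K)
    (f : ratfun K) : Prop :=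
  reg0 (of_poly (div0 x) * f).

Definition log_formoo (K : fieldType) (m : nat) (x : 'I_m -> K * K)
    (f : ratfun K) : Prop :=
  regoo (of_poly_inv (divoo x) * (tvar K ^+ 2 * f)).

Definition is_log_higgs (K : fieldType) (m : nat) (x : 'I_m -> K * K)
    (r : nat) (E : higgs K r) : Prop :=
  [/\ is_bundle (htrans E),
      mx_in (log_form0 x) (hfield E)
    & mx_in (log_formoo x) (htrans E *m hfield E *m invmx (htrans E))].

(* Isomorphisms, given by their matrices B0 and Boo in the two charts. *)
Definition bundle_iso (K : fieldType) (r : nat) (g g' B0 Boo : 'M[ratfun K]_r) :
    Prop :=
  [/\ GL_in (@reg0 K) B0, GL_in (@regoo K) Boo & g' *m B0 = Boo *m g].

Definition higgs_iso (K : fieldType) (r : nat) (E E' : higgs K r) : Prop :=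
  exists B0 Boo : 'M[ratfun K]_r,
    bundle_iso (htrans E) (htrans E') B0 Boo /\
    hfield E' *m B0 = B0 *m hfield E.

Definition conn_iso (K : fieldType) (r : nat) (V V' : conn K r) : Prop :=
  exists B0 Boo : 'M[ratfun K]_r,
    bundle_iso (ctrans V) (ctrans V') B0 Boo /\
    map_mx (@ddt K) B0 + cmatrix V' *m B0 = B0 *m cmatrix V.

Definition htwist (K : fieldType) (r : nat) (n : int) (E : higgs K r) :
    higgs K r :=
  Higgs (tvar K ^ (- n) *: htrans E) (hfield E).

(* exp of a nilpotent matrix of exponent <= p, in characteristic p. *)
Definition expmx (F : fieldType) (p r : nat) (N : 'M[F]_r) : 'M[F]_r :=
  \sum_(n < p) (n`!%:R)^-1 *: N ^+ n.

Definition frobmx (F : fieldType) (p r : nat) (A : 'M[F]_r) : 'M[F]_r :=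
  map_mx (fun f : F => f ^+ p) A.

(* (Phi_0(t) - t^p) / p, for the lifting t |-> t^p + p c(t) on U_0. *)
Definition corr0 (K : fieldType) (c : {poly K}) : ratfun K := of_poly c.

(* (Phi_oo(t) - t^p) / p, for the lifting u |-> u^p + p c(u) on U_oo: modulo
   p^2, Phi_oo(t) = (u^p + p c(u))^-1 = t^p - p t^(2 p) c(1 / t). *)
Definition corroo (K : fieldType) (p : nat) (c : {poly K}) : ratfun K :=
  - (tvar K ^+ (2 * p) * of_poly_inv c).

(* phi0 and phioo are the (Phi_i(t) - t^p) / p.  The absolute Frobenius
   pull-back raises functions to the power p, and takes theta = A dt to
   A^(p) F^*dt, with (d Phi_0 / p) (F^*dt) = (t^(p-1) + phi0') dt and
   h(F^*dt) = phi0 - phioo.  As F^*A and F^*g have zero derivative, the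
   connection given here in the frame F^*e_0 is, in the frame F^*e_oo,
   d + (t^(p-1) + phioo') F^*(g A g^-1) dt, i.e. the one defined by Phi_oo. *)
Definition inv_cartier (K : fieldType) (p : nat) (phi0 phioo : ratfun K)
    (r : nat) (E : higgs K r) : conn K r :=
  let N := frobmx p (hfield E) in
  Conn (frobmx p (htrans E) *m expmx p ((phi0 - phioo) *: N))
       ((tvar K ^+ p.-1 + ddt phi0) *: N).

Definition pair2 (T : Type) (a b : T) : 'I_2 -> T :=
  fun i => if i == ord0 then a else b.

(* Gr of (L + L', nabla) with L + L' of diagonal transition matrix and the
   filtration 0 < L < L + L' by the first summand: the Higgs field is the
   O-linear map L -> L' (x) Omega^1(log D) induced by nabla. *)
Definition gr (K : fieldType) (V : conn K 2) : higgs K 2 :=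
  Higgs (ctrans V) (cmatrix V ord_max ord0 *: delta_mx ord_max ord0).

(* (O(1) + O, theta), with theta a nonzero map O(1) -> O (x) Omega^1(log D). *)
Definition in_M10 (K : fieldType) (m : nat) (x : 'I_m -> K * K)
    (E : higgs K 2) : Prop :=
  [/\ htrans E = split_bundle K (pair2 1 0),
      is_log_higgs x E,
      (forall i j, (i, j) != (ord_max, ord0) -> hfield E i j = 0)
    & hfield E ord_max ord0 != 0].

(* The identification of M(1,0) with P(H^0(P^1, O(m - 3))) = P^(m - 3): such
   a theta is s(t) dt / div0 with s a nonzero polynomial of degree <= m - 3,
   whose coefficients are the homogeneous coordinates of the point. *)
Definition M10_coord (K : fieldType) (m : nat) (x : 'I_m -> K * K)
    (s : 'I_(m - 2) -> K) (E : higgs K 2) : Prop :=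
  in_M10 x E /\
  hfield E ord_max ord0 =
    of_poly (\sum_(i < m - 2) s i *: 'X^i) / of_poly (div0 x).

(* E' is the image of E: the bundle underlying C_1^-1(E) is isomorphic to
   O((p+1)/2) + O((p-1)/2), and E' to Gr tensored with O((1-p)/2). *)
Definition flow_step (K : fieldType) (p : nat) (phi0 phioo : ratfun K)
    (E E' : higgs K 2) : Prop :=
  exists V : conn K 2,
    [/\ ctrans V = split_bundle K (pair2 (p.+1./2)%:Z (p.-1./2)%:Z),
        conn_iso (inv_cartier p phi0 phioo E) V
      & higgs_iso (htwist (- (p.-1./2)%:Z) (gr V)) E'].

(* The graph of phi on homogeneous coordinates of K-points. *)
Definition flow_map (K : fieldType) (p m : nat) (x : 'I_m -> K * K)
    (c0 coo : {poly K}) (s s' : 'I_(m - 2) -> K) : Prop :=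
  exists E E' : higgs K 2,
    [/\ M10_coord x s E, M10_coord x s' E'
      & flow_step p (corr0 c0) (corroo p coo) E E'].

(* For a rational self-map of P^(n-1), given by its graph on K-points with K
   algebraically closed: the image of every nonempty open subset {g <> 0} of
   the source is dense, i.e. meets every nonempty open subset {f <> 0} of the
   target. *)
Definition dominant (K : fieldType) (n : nat)
    (phi : ('I_n -> K) -> ('I_n -> K) -> Prop) : Prop :=
  forall (d e : nat) (g f : {mpoly K[n]}),
    g \is d.-homog -> g != 0 -> f \is e.-homog -> f != 0 ->
    exists s s' : 'I_n -> K, [/\ phi s s', g.@[s] != 0 & f.@[s'] != 0].

(* Main.v *)
Require Import Defs.
From HB Require Import structures.
From mathcomp Require Import all_boot all_order all_algebra generic_quotient.
From mathcomp Require Import mpoly.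
From mathcomp Require Import ring zify.

Set Implicit Arguments.
Unset Strict Implicit.
Unset Printing Implicit Defensive.

Import GRing.Theory.
Local Open Scope ring_scope.

(* Write s(t) dt / P for the Higgs field, P being the equation of D, p = 2r + 1
   and n = m - 2.  The bundle V is the extension of O(p) by O with class
   F = h s^p / P^p, where h = (Phi_0 - Phi_oo) / p is divisible by P^p because
   the liftings are logarithmic.  A map O(r + 1) -> V is a Pade approximant of
   F: a polynomial a of degree <= r such that the coefficients of t^-1, ..., t^-r
   in F a vanish; it is given by the minors of a Hankel matrix, which are
   polynomials in s.  The new Higgs field s' satisfies
   s'(x_i) = e(x_i) a(x_i)^2 s(x_i)^p at the marked points, with e(x_i) <> 0, and
   it is nonzero as t^(p-1) dt times a p-th power is not exact.

   In the coordinates y_i = s(x_i), for n finite marked points, the map is thus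
   y'_i = H_i(y) y_i^p.  At the i-th basis vector s' vanishes at the n - 1 other
   points, so that s'(x_i) = 0 would give s' = 0: hence H_i does not vanish
   there.  On each coordinate subspace y_(k+1) = ... = y_n = 0 the map therefore
   restricts to a self-map with y'_k not identically 0 and divisible by y_k, and
   dominance follows by induction on k. *)

(** * Algebraic independence of a triangular map *)

(** Stands in for polynomial functions of several variables: it is stable under sums, products,
    determinants and linear substitutions, and restriction to lines suffices to find common nonzero
    points. The point [w] is described coordinatewise because functions that agree pointwise need
    not be equal. *)
Definition poly_on_lines (K : nzRingType) (n : nat) (F : ('I_n -> K) -> K) :
    Prop :=
  forall u v : 'I_n -> K, exists q : {poly K}, forall (t : K) (w : 'I_n -> K),
    (forall i, w i = u i + t * (v i - u i)) -> F w = q.[t].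

Section PolyOnLines.
Variables (K : comNzRingType) (n : nat).
Implicit Types F G : ('I_n -> K) -> K.

Lemma poly_on_lines_cst c : poly_on_lines (fun _ : 'I_n -> K => c).
Proof. by move=> u v; exists c%:P => t w _; rewrite hornerC. Qed.

Lemma poly_on_lines_coord i : poly_on_lines (fun w : 'I_n -> K => w i).
Proof.
move=> u v; exists ((u i)%:P + 'X * (v i - u i)%:P) => t w ->.
by rewrite !hornerE.
Qed.

Lemma poly_on_linesD F G :
  poly_on_lines F -> poly_on_lines G -> poly_on_lines (fun w => F w + G w).
Proof.
move=> HF HG u v; have [a Ha] := HF u v; have [b Hb] := HG u v.
by exists (a + b) => t w Hw; rewrite (Ha t) // (Hb t) // hornerD.
Qed.

Lemma poly_on_linesM F G :
  poly_on_lines F -> poly_on_lines G -> poly_on_lines (fun w => F w * G w).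
Proof.
move=> HF HG u v; have [a Ha] := HF u v; have [b Hb] := HG u v.
by exists (a * b) => t w Hw; rewrite (Ha t) // (Hb t) // hornerM.
Qed.

Lemma eq_poly_on_lines F G : F =1 G -> poly_on_lines F -> poly_on_lines G.
Proof.
move=> E HF u v; have [a Ha] := HF u v.
by exists a => t w Hw; rewrite -E (Ha t).
Qed.

Lemma poly_on_linesN F : poly_on_lines F -> poly_on_lines (fun w => - F w).
Proof.
move=> HF; apply: eq_poly_on_lines (poly_on_linesM (poly_on_lines_cst (-1)) HF).
by move=> w; rewrite mulN1r.
Qed.

Lemma poly_on_lines_sum (I : Type) (r : seq I) (P : pred I)
    (F : I -> ('I_n -> K) -> K) :
  (forall i, poly_on_lines (F i)) ->
  poly_on_lines (fun w => \sum_(i <- r | P i) F i w).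
Proof.
move=> HF; elim: r => [|i r IH].
  by apply: eq_poly_on_lines (poly_on_lines_cst 0) => w; rewrite big_nil.
case Pi : (P i).
  by apply: eq_poly_on_lines (poly_on_linesD (HF i) IH) => w;
     rewrite big_cons Pi.
by apply: eq_poly_on_lines IH => w; rewrite big_cons Pi.
Qed.

Lemma poly_on_lines_prod (I : Type) (r : seq I) (P : pred I)
    (F : I -> ('I_n -> K) -> K) :
  (forall i, poly_on_lines (F i)) ->
  poly_on_lines (fun w => \prod_(i <- r | P i) F i w).
Proof.
move=> HF; elim: r => [|i r IH].
  by apply: eq_poly_on_lines (poly_on_lines_cst 1) => w; rewrite big_nil.
case Pi : (P i).
  by apply: eq_poly_on_lines (poly_on_linesM (HF i) IH) => w;
     rewrite big_cons Pi.
by apply: eq_poly_on_lines IH => w; rewrite big_cons Pi.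
Qed.

Lemma poly_on_linesX F k : poly_on_lines F -> poly_on_lines (fun w => F w ^+ k).
Proof.
move=> HF; elim: k => [|k IH].
  exact: eq_poly_on_lines (poly_on_lines_cst 1).
by apply: eq_poly_on_lines (poly_on_linesM HF IH) => w; rewrite exprS.
Qed.

Lemma poly_on_lines_det r (A : ('I_n -> K) -> 'M[K]_r) :
  (forall i j, poly_on_lines (fun w => A w i j)) ->
  poly_on_lines (fun w => \det (A w)).
Proof.
move=> HA; apply: poly_on_lines_sum => s; apply: poly_on_linesM.
  exact: poly_on_lines_cst.
exact: poly_on_lines_prod.
Qed.

Lemma poly_on_lines_meval k (f : {mpoly K[k]}) (F : ('I_n -> K) -> 'I_k -> K) :
  (forall i, poly_on_lines (fun w => F w i)) ->
  poly_on_lines (fun w => f.@[F w]).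
Proof.
move=> HF; apply: (@eq_poly_on_lines
  (fun w => \sum_(m <- msupp f) f@_m * \prod_i F w i ^+ m i)).
  by move=> w; rewrite mevalE.
apply: poly_on_lines_sum => m; apply: poly_on_linesM.
  exact: poly_on_lines_cst.
by apply: poly_on_lines_prod => i; apply: poly_on_linesX.
Qed.

Lemma poly_on_lines_comp_lin k (c : 'I_k -> 'I_n -> K) (F : ('I_k -> K) -> K) :
  poly_on_lines F ->
  poly_on_lines (fun w : 'I_n -> K => F (fun j => \sum_i w i * c j i)).
Proof.
move=> HF u v.
have [q Hq] := HF (fun j => \sum_i u i * c j i) (fun j => \sum_i v i * c j i).
exists q => t w Hw; apply: Hq => j.
rewrite -sumrB mulr_sumr -big_split; apply: eq_bigr => i _ /=.
by rewrite Hw; ring.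
Qed.

End PolyOnLines.

(** Irreducibility of affine space, seen on the line through [u] (t = 0) and [v] (t = 1): both
    restrictions are nonzero polynomials in t, so their product has a nonroot in K. *)
Lemma poly_on_lines_nonzero_both (K : closedFieldType) (n : nat)
    (F G : ('I_n -> K) -> K) (u v : 'I_n -> K) :
  poly_on_lines F -> poly_on_lines G -> F u != 0 -> G v != 0 ->
  exists t : K, forall w, (forall i, w i = u i + t * (v i - u i)) ->
    F w != 0 /\ G w != 0.
Proof.
move=> HF HG Fu Gv; have [a Ha] := HF u v; have [b Hb] := HG u v.
have a0 : a != 0.
  apply: contraNneq Fu => a0; rewrite (Ha 0) ?a0 ?horner0 // => i.
  by rewrite mul0r addr0.
have b0 : b != 0.
  apply: contraNneq Gv => b0; rewrite (Hb 1) ?b0 ?horner0 // => i.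
  by rewrite mul1r addrC subrK.
have /closed_nonrootP[t] : a * b != 0 by rewrite mulf_neq0.
rewrite rootM negb_or => /andP[at0 bt0]; exists t => w Hw.
by rewrite (Ha t) // (Hb t).
Qed.

(* Induction on the number k of variables: on the span of the first k + 1
   coordinates f is y_k^a f1 with f1 not divisible by y_k, and the k-th
   component of the map is a multiple of y_k that does not vanish at the k-th
   basis vector; so it is enough to treat f1 on y_k = 0. *)
Lemma triangular_map_nonvanishing (K : closedFieldType) (n p : nat)
    (H : 'I_n -> ('I_n -> K) -> K) (f : {mpoly K[n]}) :
  (0 < p)%N -> (forall i, poly_on_lines (H i)) ->
  (forall i w, (forall j, w j = (j == i)%:R) -> H i w != 0) ->
  f != 0 ->
  exists y : 'I_n -> K, f.@[fun i => H i y * y i ^+ p] != 0.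
Proof.
move=> p0 HH He f0.
(* The monomial [mo] expresses that f is not identically zero on the subspace where the coordinates
   of index at least k vanish. *)
suff IH k : (k <= n)%N -> forall f : {mpoly K[n]},
    (exists2 mo, mo \in msupp f & forall i : 'I_n, (k <= i)%N -> mo i = 0%N) ->
    exists2 y : 'I_n -> K, f.@[fun i => H i y * y i ^+ p] != 0 &
      forall i : 'I_n, (k <= i)%N -> y i = 0.
  have [|y Hy _] := IH n (leqnn n) f; last by exists y.
  exists (mlead f); first exact: mlead_supp.
  by move=> i; rewrite leqNgt ltn_ord.
elim: k => [_|k IH kn] {f0}f [mo mof mo0].
  (* For k = 0 the exponent [mo] is zero, and the value of f at the origin is the coefficient of
     [mo]. *)
  exists (fun _ => 0) => //.
  rewrite (@meval_eq _ _ _ (fun _ => 0)); last first.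
    by move=> i; rewrite expr0n eqn0Ngt p0 mulr0.
  rewrite mevalE (bigD1_seq mo) ?msupp_uniq //= [X in _ + X]big1 => [|mo' /negP mo'0].
    rewrite addr0 big1 ?mulr1; first by rewrite -mcoeff_msupp.
    by move=> i _; rewrite mo0.
  have [[i mi]|/existsPn h] := altP (@existsP _ (fun i => mo' i != 0%N)).
    by rewrite (bigD1 i) //= expr0n (negPf mi) mul0r mulr0.
  case: mo'0; apply/eqP/mnmP => i; rewrite mo0 //.
  by apply/eqP; have := h i; rewrite negbK.
pose ik := Ordinal kn.
pose sup (mo : 'X_{1..n}) := [forall i : 'I_n, (k < i)%N ==> (mo i == 0%N)].
have supP (mo' : 'X_{1..n}) : reflect (forall i : 'I_n, (k < i)%N -> mo' i = 0%N) (sup mo').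
  apply: (iffP forallP) => [h i ki|h i]; last by apply/implyP => /h ->.
  by apply/eqP; move/implyP: (h i); apply.
pose Q a := has (fun mo => sup mo && (mo ik == a)) (msupp f).
have exQ : exists a, Q a.
  by exists (mo ik); apply/hasP; exists mo; rewrite // eqxx andbT; apply/supP.
(* Here a is the exact power of the coordinate [ik] that divides the restriction of f to the first k
   + 1 coordinates; [f1] below is the quotient. *)
case: (ex_minnP exQ) => a /hasP[mo1 mo1f /andP[s1 /eqP m1a]] mina.
have min' mo' : mo' \in msupp f -> sup mo' -> (a <= mo' ik)%N.
  by move=> h1 h2; apply: mina; apply/hasP; exists mo'; rewrite // h2 eqxx.
pose sh (mo : 'X_{1..n}) := (mo - U_(ik) *+ a)%MM.
have shE (mo' : 'X_{1..n}) i : sh mo' i = (mo' i - (ik == i) * a)%N.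
  by rewrite /sh mnmBE mulmnE mnm1E.
pose f1 := \sum_(mo <- msupp f | sup mo) f@_mo *: 'X_[K, sh mo].
have f1E y : (forall i : 'I_n, (k < i)%N -> y i = 0) ->
    f.@[y] = y ik ^+ a * f1.@[y].
  move=> y0; rewrite mevalE /f1 rmorph_sum mulr_sumr /=.
  rewrite [RHS]big_seq_cond [LHS](bigID sup) /= [X in _ + X]big1 => [|mo'].
    rewrite addr0 [LHS]big_seq_cond; apply: eq_bigr => mo' /andP[h1 h2].
    rewrite mevalZ mevalX mulrCA; congr (_ * _).
    rewrite (bigD1 ik) //= [X in _ = _ * X](bigD1 ik) //= mulrA.
    congr (_ * _); first by rewrite shE eqxx mul1n -exprD subnKC // min'.
    apply: eq_bigr => i ni; rewrite shE.
    by rewrite eq_sym (negPf ni) mul0n subn0.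
  rewrite negb_forall => /existsP[i]; rewrite negb_imply => /andP[ki mi].
  by rewrite (bigD1 i) //= y0 // expr0n (negPf mi) mul0r mulr0.
have f1c : sh mo1 \in msupp f1.
  rewrite mcoeff_msupp /f1 raddf_sum /= -big_filter (bigD1_seq mo1) /=; last 2 first.
  - by rewrite mem_filter s1.
  - by rewrite filter_uniq // msupp_uniq.
  rewrite big_seq_cond big1 => [|mo'].
    by rewrite addr0 mcoeffZ mcoeffX eqxx mulr1 -mcoeff_msupp.
  rewrite mem_filter => /andP[/andP[s' m'f] ne].
  rewrite mcoeffZ mcoeffX; case: eqP => [e|_]; last by rewrite mulr0.
  case/eqP: ne; apply/mnmP => i; move/mnmP/(_ i): e; rewrite !shE.
  case: eqP => [<-|_]; last by rewrite mul0n !subn0.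
  (* The truncated subtraction in [sh] is injective here, since both exponents at [ik] are at least
     a. *)
  have := min' _ m'f s'; have := min' _ mo1f s1; lia.
have [|y1 Hy1 y10] := IH (ltnW kn) f1.
  exists (sh mo1) => // i ki; rewrite shE.
  have [<-|ne] := eqVneq ik i; first by rewrite m1a mul1n subnn.
  rewrite mul0n subn0; apply: (elimT (supP mo1)) => //.
  by rewrite ltn_neqAle ki andbT; apply: contraNneq ne => e; apply/eqP/val_inj.
(* On the line from the basis vector [ek] to [y1], the component [ik] of the map is nonzero at the
   first end and [f1] composed with the map is nonzero at the second. *)
pose ek (j : 'I_n) : K := (j == ik)%:R.
have HM : poly_on_lines (fun y => H ik y * y ik ^+ p).
  by apply: poly_on_linesM => //; apply/poly_on_linesX/poly_on_lines_coord.
have [||t Ht] := @poly_on_lines_nonzero_both _ _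
    (fun y => H ik y * y ik ^+ p)
    (fun y => f1.@[fun i => H i y * y i ^+ p]) ek y1 HM _ _ Hy1.
- apply: poly_on_lines_meval => i.
  by apply: poly_on_linesM => //; apply/poly_on_linesX/poly_on_lines_coord.
- by rewrite {2}/ek eqxx expr1n mulr1 He.
have [//|h1 h2] := Ht (fun i => ek i + t * (y1 i - ek i)).
exists (fun i => ek i + t * (y1 i - ek i)).
  have y0 (i : 'I_n) : (k < i)%N -> ek i + t * (y1 i - ek i) = 0.
    move=> ki; rewrite y10 1?ltnW // /ek -val_eqE /= (gtn_eqF ki).
    by rewrite subrr mulr0 addr0.
  rewrite f1E ?mulf_neq0 ?expf_neq0 //.
  by move=> i ki; rewrite y0 // expr0n eqn0Ngt p0 mulr0.
move=> i ki; rewrite y10 1?ltnW // /ek -val_eqE /= (gtn_eqF ki).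
by rewrite subrr mulr0 addr0.
Qed.

(** The identity is the triangular map with H = 1 and p = 1. *)
Lemma mpoly_nonvanishing (K : closedFieldType) (n : nat) (f : {mpoly K[n]}) :
  f != 0 -> exists y : 'I_n -> K, f.@[y] != 0.
Proof.
move=> f0.
have [||||y Hy] := @triangular_map_nonvanishing K n 1 (fun _ _ => 1) f.
- by [].
- by move=> i; exact: poly_on_lines_cst.
- by move=> *; exact: oner_neq0.
- exact: f0.
- by exists y; rewrite (@meval_eq _ _ _ (fun i => 1 * y i ^+ 1)) // => i;
     rewrite mul1r expr1.
Qed.

(** * The local equations of the divisor *)

(* The polynomial X^M f(1/X); it is meant for size f <= M.+1. *)
Definition revp (R : nzSemiRingType) (M : nat) (f : {poly R}) : {poly R} :=
  \poly_(i < M.+1) f`_(M - i).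

Section Reversal.
Variable R : comNzRingType.
Implicit Types f g : {poly R}.

Lemma coef_revp M f i : (revp M f)`_i = if (i <= M)%N then f`_(M - i) else 0.
Proof. by rewrite coef_poly ltnS. Qed.

Lemma size_revp M f : (size (revp M f) <= M.+1)%N.
Proof. exact: size_poly. Qed.

Lemma revpD M f g : revp M (f + g) = revp M f + revp M g.
Proof.
by apply/polyP => i; rewrite !(coefD, coef_revp); case: ifP; rewrite ?addr0.
Qed.

Lemma revpZ M c f : revp M (c *: f) = c *: revp M f.
Proof.
by apply/polyP => i; rewrite !(coefZ, coef_revp); case: ifP; rewrite ?mulr0.
Qed.

Lemma revpB M f g : revp M (f - g) = revp M f - revp M g.
Proof. by rewrite -scaleN1r revpD revpZ scaleN1r. Qed.

Lemma revp0 M : revp M (0 : {poly R}) = 0.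
Proof. by apply/polyP => i; rewrite coef_revp !coef0; case: ifP. Qed.

Lemma revp_sum M I (r : seq I) (P : pred I) (F : I -> {poly R}) :
  revp M (\sum_(i <- r | P i) F i) = \sum_(i <- r | P i) revp M (F i).
Proof. exact: (big_morph _ (revpD M) (revp0 M)). Qed.

Lemma revpXnM a b i g : (i <= a)%N -> (size g <= b.+1)%N ->
  revp (a + b) ('X^i * g) = 'X^(a - i) * revp b g.
Proof.
move=> ia sg; apply/polyP => k; rewrite !(coef_revp, coefXnM).
have [kab|kab] := leqP k (a + b); last first.
  by case: ifP => // _; case: ifP => //; lia.
have [h1|h1] := ltnP (a + b - k) i; have [h2|h2] := ltnP k (a - i) => //.
- by case: ifP => //; lia.
- by rewrite nth_default //; apply: leq_trans sg _; lia.
case: ifP => [_|]; last by lia.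
by congr nth; lia.
Qed.

Lemma revp1 : revp 0 (1 : {poly R}) = 1.
Proof. by apply/polyP => k; rewrite coef_revp !coef1 leqn0; case: eqP. Qed.

Lemma revpXn M i : (i <= M)%N -> revp M ('X^i : {poly R}) = 'X^(M - i).
Proof.
move=> iM; have := @revpXnM M 0 i 1 iM; rewrite addn0 mulr1 => -> //.
  by rewrite revp1 mulr1.
by rewrite size_poly1.
Qed.

Lemma revpM a b (f g : {poly R}) : (size f <= a.+1)%N -> (size g <= b.+1)%N ->
  revp (a + b) (f * g) = revp a f * revp b g.
Proof.
move=> sf sg; have -> : f = \sum_(i < a.+1) f`_i *: 'X^i.
  rewrite -(poly_def a.+1 (fun i => f`_i)); apply/polyP => i; rewrite coef_poly.
  by case: ltnP => // h; rewrite nth_default // (leq_trans sf).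
rewrite mulr_suml !revp_sum mulr_suml; apply: eq_bigr => i _.
have ia : (i <= a)%N by rewrite -ltnS.
by rewrite -scalerAl !revpZ -scalerAl revpXnM // revpXn.
Qed.

Lemma size_polyM_le a b (f g : {poly R}) : (size f <= a.+1)%N -> (size g <= b.+1)%N ->
  (size (f * g)%R <= (a + b).+1)%N.
Proof.
move=> sf sg; apply: leq_trans (size_polyMleq _ _) _.
lia.
Qed.

Lemma size_polyX_le a k f : (size f <= a.+1)%N -> (size (f ^+ k)%R <= (k * a).+1)%N.
Proof.
move=> sf; elim: k => [|k IH]; first by rewrite expr0 size_poly1.
by rewrite exprS mulSn; apply: size_polyM_le.
Qed.

Lemma revpX a k f : (size f <= a.+1)%N -> revp (k * a) (f ^+ k) = revp a f ^+ k.
Proof.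
move=> sf; elim: k => [|k IH].
  by rewrite !expr0 revp1.
by rewrite !exprS mulSn revpM ?IH //; apply: size_polyX_le.
Qed.

Lemma size_prod_le a n (F : 'I_n -> {poly R}) :
  (forall i, size (F i) <= a.+1)%N -> (size (\prod_i F i)%R <= (n * a).+1)%N.
Proof.
elim: n F => [|n IH] F sF; first by rewrite big_ord0 size_poly1.
by rewrite big_ord_recl mulSn; apply: size_polyM_le => //; apply: IH.
Qed.

Lemma revp_prod a n (F : 'I_n -> {poly R}) : (forall i, size (F i) <= a.+1)%N ->
  revp (n * a) (\prod_i F i) = \prod_i revp a (F i).
Proof.
elim: n F => [|n IH] F sF.
  by rewrite !big_ord0 revp1.
by rewrite !big_ord_recl mulSn revpM ?IH //; apply: size_prod_le.
Qed.

Lemma revpK M f : (size f <= M.+1)%N -> revp M (revp M f) = f.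
Proof.
move=> sf; apply/polyP => i; rewrite !coef_revp leq_subr.
by case: leqP => h; rewrite ?subKn // nth_default // (leq_trans sf).
Qed.

(* X d/dX acts on X^i as i and on X^(M-i) as M - i. *)
Lemma revpXderiv M f : (size f <= M.+1)%N ->
  revp M ('X * f^`()) = M%:R *: revp M f - 'X * (revp M f)^`().
Proof.
move=> sf; apply/polyP => i.
rewrite coefB coefZ !coef_revp !coefXM !coef_deriv.
case: i => [|i] /=.
  rewrite subn0 subr0; case: M sf => [|M] sf /=; first by rewrite mul0r.
  by rewrite mulr_natl.
rewrite coef_revp; case: ltnP => h; last by rewrite mulr0 mul0rn subr0.
have [h'|h'] := eqVneq (M - i.+1)%N 0%N.
  by rewrite h' /= mulr_natl -mulrnBr // h' mulr0n.
rewrite mulr_natl -mulrnBr // (_ : (M - i.+1).-1.+1 = (M - i.+1)%N) //; lia.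
Qed.

End Reversal.

Lemma map_revp (R S : comNzRingType) (rho : {rmorphism R -> S}) M (f : {poly R}) :
  map_poly rho (revp M f) = revp M (map_poly rho f).
Proof.
apply/polyP => i; rewrite coef_map !coef_revp coef_map.
case: ifP => _ //; exact: rmorph0.
Qed.

Section Divisor.
Variables (R : comNzRingType) (m : nat) (x : 'I_m -> R * R).

Lemma size_lin (a b : R) : (size (b *: 'X - a%:P)%R <= 2)%N.
Proof.
apply: leq_trans (size_polyD _ _) _; rewrite geq_max size_polyN.
rewrite (leq_trans (size_scale_leq _ _)) ?size_polyX //.
by rewrite (leq_trans (size_polyC_leq1 _)).
Qed.

Lemma size_lin' (a b : R) : (size (b%:P - a *: 'X)%R <= 2)%N.
Proof. by rewrite -opprB size_polyN; apply: size_lin. Qed.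

Lemma size_div0 : (size (div0 x) <= m.+1)%N.
Proof. by rewrite -[m in m.+1]muln1; apply: size_prod_le => i; apply: size_lin. Qed.

Lemma size_divoo : (size (divoo x) <= m.+1)%N.
Proof. by rewrite -[m in m.+1]muln1; apply: size_prod_le => i; apply: size_lin'. Qed.

Lemma revp_lin (q : nat) (a b : R) :
  revp q (b%:P - a *: 'X^q) = b *: 'X^q - a%:P.
Proof.
rewrite revpB revpZ revpXn // subnn expr0 -(alg_polyC b) -(alg_polyC a) revpZ.
by congr (_ *: _ - _); rewrite -(expr0 'X) revpXn // subn0.
Qed.

Lemma revp_divoo : revp m (divoo x) = div0 x.
Proof.
rewrite -[m in revp m]muln1 revp_prod => [|i]; last exact: size_lin'.
by apply: eq_bigr => i _; rewrite -(expr1 'X) revp_lin.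
Qed.

End Divisor.

(** * Reduction modulo p of the logarithmic Frobenius liftings *)

Lemma exprp_poly (p : nat) (K : fieldType) (f : {poly K}) : p \in [pchar K] ->
  f ^+ p = map_poly (fun c => c ^+ p) f \Po 'X^p.
Proof.
move=> chp; have chpp : [pchar {poly K}].-nat p.
  rewrite pnatE ?(pcharf_prime chp) // inE (pcharf_prime chp) /=.
  by rewrite -polyC_natr (pcharf0 chp).
have p0 : (0 < p)%N by rewrite prime_gt0 ?(pcharf_prime chp).
have E (q : {poly K}) : map_poly (fun c => c ^+ p) q = map_poly (pFrobenius_aut chp) q.
  by apply: eq_map_poly => c; rewrite pFrobenius_autE.
rewrite E; elim/poly_ind: f => [|f c IH].
  by rewrite rmorph0 comp_poly0 expr0n eqn0Ngt p0.
rewrite exprDn_pchar // exprMn IH rmorphD rmorphM /= map_polyX map_polyC /=.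
by rewrite comp_polyD comp_polyM comp_polyX comp_polyC -polyC_exp pFrobenius_autE.
Qed.

Lemma comp_poly_taylor1 (R : comNzRingType) (f a h : {poly R}) :
  exists g, f \Po (a + h) = f \Po a + h * (f^`() \Po a) + h ^+ 2 * g.
Proof.
elim/poly_ind: f => [|f c [g IH]].
  by exists 0; rewrite deriv0 !comp_poly0 !mulr0 !addr0.
exists (f^`() \Po a + g * (a + h)).
rewrite derivD derivM derivX derivC mulr1 addr0.
by rewrite !(comp_polyD, comp_polyM, comp_polyX, comp_polyC) IH; ring.
Qed.

Section WittReduction.
Variables (p : nat) (W : comNzRingType) (K : fieldType).
Variables (sigma : {rmorphism W -> W}) (rho : {rmorphism W -> K}).
Hypothesis char_K : p \in [pchar K].
Hypothesis rho_ker : forall x, rho x = 0 -> exists z, x = p%:R * z.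
Hypothesis torsionfree : forall x : W, p%:R * x = 0 -> x = 0.
Hypothesis rho_frob : forall x, rho (sigma x) = rho x ^+ p.

Lemma scalep_inj (f g : {poly W}) : p%:R *: f = p%:R *: g -> f = g.
Proof.
move=> e; apply/polyP => i; apply/eqP; rewrite -subr_eq0; apply/eqP.
apply: torsionfree; rewrite mulrBr -!coefZ e; exact: subrr.
Qed.

Lemma map_poly_ker (f : {poly W}) :
  map_poly rho f = 0 -> exists g, f = p%:R *: g.
Proof.
move=> f0; have {f0} : forall i, rho f`_i = 0.
  by move=> i; rewrite -coef_map f0 coef0.
elim/poly_ind: f => [|f c IH] f0; first by exists 0; rewrite scaler0.
have [z cz] : exists z, c = p%:R * z.
  by apply: rho_ker; have := f0 0%N; rewrite coefD coefMX coefC /= add0r.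
have [i|g fg] := IH.
  by have := f0 i.+1; rewrite coefD coefMX coefC /= addr0.
by exists (g * 'X + z%:P); rewrite fg cz scalerDr scalerAl -!mul_polyC polyCM.
Qed.

Lemma rho_p : rho p%:R = 0.
Proof. by rewrite rmorph_nat (pcharf0 char_K). Qed.

Lemma map_poly_frob (P : {poly W}) :
  map_poly rho (map_poly sigma P \Po 'X^p) = map_poly rho P ^+ p.
Proof.
rewrite map_comp_poly map_polyXn exprp_poly // -!map_poly_comp_id0 ?rmorph0 //.
- by congr (_ \Po _); apply: eq_map_poly => c /=; rewrite rho_frob.
- by rewrite expr0n; case: (p) (pcharf_prime char_K).
Qed.

(** Here [d] is (P^p - P^sigma(X^p)) / p and [w] is the reduction of (u - 1) / p. Expanding
    P^sigma(X^p + p c) to first order in p, comparing with u P^p and dividing by p gives the first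
    relation. The second comes from differentiating p d over W and dividing by p before reducing,
    since (P^p)' is lost modulo p. *)
Lemma log_frob_lift_reduction (P c : {poly W}) :
  log_frob_lift p sigma P c -> map_poly rho P != 0 ->
  exists (d : {poly W}) (w : {poly K}),
    let Pb := map_poly rho P in let db := map_poly rho d in
    [/\ p%:R%:P * d = P ^+ p - (map_poly sigma P \Po 'X^p),
        map_poly rho c * Pb^`() ^+ p = db + w * Pb ^+ p
      & db^`() = Pb ^+ p.-1 * Pb^`() - 'X^(p.-1) * Pb^`() ^+ p].
Proof.
move=> [u [v [_ [h2 Hu]]]] P0.
have p1 : (0 < p)%N by rewrite prime_gt0 ?(pcharf_prime char_K).
have [d Hd] : exists d, P ^+ p - (map_poly sigma P \Po 'X^p) = p%:R *: d.
  by apply: map_poly_ker; rewrite rmorphB rmorphXn /= map_poly_frob subrr.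
have [g] := comp_poly_taylor1 (map_poly sigma P) 'X^p (p%:R *: c).
move: Hu Hd; rewrite /frob_lift -!mul_polyC => Hu Hd Hg; rewrite {}Hg polyC_exp in Hu.
set A := map_poly sigma P \Po 'X^p in Hu Hd.
set B := (map_poly sigma P)^`() \Po 'X^p in Hu.
have rA : map_poly rho A = map_poly rho P ^+ p by exact: map_poly_frob.
have rB : map_poly rho B = (map_poly rho P)^`() ^+ p.
  by rewrite /B deriv_map map_poly_frob deriv_map.
have rp : map_poly rho (p%:R%:P) = 0 by rewrite map_polyC /= rho_p.
(* Modulo p the lifting condition reads P^p = u P^p, and P is nonzero there, so u reduces to 1. *)
have [w] : exists w, u - 1 = p%:R *: w.
  apply: map_poly_ker; have := congr1 (map_poly rho) Hu.
  rewrite !(rmorphB, rmorphD, rmorphM, rmorphXn, rmorph1) /= rp rA.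
  rewrite !expr2 !mul0r !addr0 => /eqP.
  rewrite -{1}[_ ^+ p]mul1r -mulrBl mulf_eq0 expf_eq0 (negPf P0) andbF orbF.
  by rewrite -opprB oppr_eq0 => /eqP.
rewrite -mul_polyC => Hw.
exists d, (map_poly rho w) => /=; split=> //.
  have E : c * B = d + w * P ^+ p + p%:R%:P * (h2 - c ^+ 2 * g).
    apply: scalep_inj; rewrite -!mul_polyC.
    have -> : p%:R%:P * (c * B) =
      (A + p%:R%:P * c * B + (p%:R%:P * c) ^+ 2 * g - u * P ^+ p)
      + (u - 1) * P ^+ p + (P ^+ p - A) - (p%:R%:P * c) ^+ 2 * g by ring.
    by rewrite Hu Hd Hw; ring.
  have := congr1 (map_poly rho) E.
  by rewrite !(rmorphB, rmorphD, rmorphM, rmorphXn) /= rp mul0r addr0 rB.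
have E : d^`() = P ^+ p.-1 * P^`() - 'X^(p.-1) * B.
  apply: scalep_inj; rewrite -derivZ -mul_polyC -Hd derivB deriv_exp /A.
  rewrite deriv_comp derivXn -/B scalerBr -!scaler_nat -!mul_polyC.
  by rewrite [P^`() * _]mulrC [B * (_ * _)]mulrCA [B * _]mulrC.
rewrite deriv_map E rmorphB !rmorphM /= map_polyXn rmorphXn /= rB.
by rewrite deriv_map.
Qed.

End WittReduction.

(** * Distinct marked points over a field and squarefreeness of the equations of D *)

Definition distinct_points (K : fieldType) (m : nat) (y : 'I_m -> K * K) : Prop :=
  forall i j, i != j -> (y i).1 * (y j).2 != (y j).1 * (y i).2.

Section DistinctPoints.
Variables (K : closedFieldType) (m : nat) (y : 'I_m -> K * K).
Hypothesis m_gt1 : (1 < m)%N.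
Hypothesis y_distinct : distinct_points y.

Lemma exists_other_ord (i : 'I_m) : exists j : 'I_m, i != j.
Proof.
have [i0|i0] := posnP i.
  by exists (Ordinal m_gt1); rewrite -val_eqE /= i0.
by exists (Ordinal (ltnW m_gt1)); rewrite -val_eqE /= -lt0n.
Qed.

Lemma point_neq0 i : (y i).1 = 0 -> (y i).2 != 0.
Proof.
move=> a0; apply/eqP => b0; have [j ij] := exists_other_ord i.
by have /eqP[] := y_distinct ij; rewrite a0 b0 mulr0 mul0r.
Qed.

Lemma lin_neq0 i : (y i).2 *: 'X - ((y i).1)%:P != 0 :> {poly K}.
Proof.
apply/eqP => /polyP e; have := e 0%N; have := e 1%N.
rewrite !(coefB, coefZ, coefX, coefC, coef0) /= mulr0 mulr1 subr0 add0r => b0.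
by move/eqP; rewrite oppr_eq0 => /eqP /point_neq0 /eqP; apply.
Qed.

Lemma div0_neq0 : div0 y != 0.
Proof. by apply/prodf_neq0 => i _; apply: lin_neq0. Qed.

Lemma root_div0P z : reflect (exists i, (y i).2 * z = (y i).1) (root (div0 y) z).
Proof.
rewrite /root horner_prod; apply: (iffP (prodf_eq0 _ _)) => [[i _]|[i zi]].
  by rewrite !hornerE subr_eq0 => /eqP zi; exists i.
by exists i; rewrite // !hornerE zi subrr.
Qed.

Lemma coprimep_div0_deriv : coprimep (div0 y) (div0 y)^`().
Proof.
apply/Pdiv.ClosedField.coprimepP => z /root_div0P[i zi].
rewrite /div0 (bigD1 i) //= derivM hornerD !hornerM derivB derivZ derivX derivC.
rewrite !hornerE zi subrr mul0r addr0 horner_prod mulf_neq0 //.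
  rewrite ?subr0; apply/eqP => b0; have := @point_neq0 i.
  by rewrite -zi b0 mul0r eqxx => /(_ erefl).
apply/prodf_neq0 => j ji; rewrite !hornerE subr_eq0; apply/eqP => zj.
by have /eqP[] := y_distinct ji; rewrite -zi -zj; ring.
Qed.

End DistinctPoints.

(** Exchanging the two coordinates of every point turns [divoo] into [div0] up to sign. *)
Lemma coprimep_divoo_deriv (K : closedFieldType) m (y : 'I_m -> K * K) :
  (1 < m)%N -> distinct_points y -> coprimep (divoo y) (divoo y)^`().
Proof.
move=> m1 yd; pose y' i := ((y i).2, (y i).1).
have -> : divoo y = (-1) ^+ m *: div0 y'.
  rewrite -[m in _ ^+ m]card_ord -mul_polyC polyC_exp polyCN -prodrN.
  by apply: eq_bigr => i _; rewrite opprB.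
have s0 : (-1) ^+ m != 0 :> K by rewrite signr_eq0.
rewrite derivZ coprimepZl // coprimepZr // coprimep_div0_deriv // => i j ij.
by rewrite eq_sym mulrC [X in _ != X]mulrC yd.
Qed.

(** * Divisibility of the Frobenius data by the equation of the divisor *)

Lemma deriv_pth_power (p : nat) (K : fieldType) (f : {poly K}) :
  p \in [pchar K] -> (f ^+ p)^`() = 0.
Proof. by move=> chp; rewrite deriv_exp -scaler_nat pcharf0 // scale0r. Qed.

Lemma subr_exprp (p : nat) (K : fieldType) (f g : {poly K}) :
  p \in [pchar K] -> (f - g) ^+ p = f ^+ p - g ^+ p.
Proof.
move=> chp; have chpp : [pchar {poly K}].-nat p.
  rewrite pnatE ?(pcharf_prime chp) // inE (pcharf_prime chp) /=.
  by rewrite -polyC_natr (pcharf0 chp).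
by rewrite exprDn_pchar // exprNn_pchar.
Qed.

(* P^(p-1) e dt is dPhi_0 / p, and P^p q / X^N is (Phi_0 - Phi_oo) / p.  The last
   field expresses on U_0 that dPhi_oo / p is divisible by the (p-1)-th power of
   the equation of D on U_oo. *)
Record frobenius_data (K : fieldType) (p m : nat) (P c0 coo : {poly K})
    (N : nat) (e q : {poly K}) : Prop := FrobeniusData {
  fd_pdivN : (p %| N)%N;
  fd_leN : (p <= N)%N;
  fd_coo : (size coo <= N.+1)%N;
  fd_e : 'X^(p.-1) + c0^`() = P ^+ p.-1 * e;
  fd_e_neq0 : forall z, root P z -> e.[z] != 0;
  fd_q : 'X^N * c0 + 'X^(2 * p) * revp N coo = P ^+ p * q;
  fd_size : (size ('X^N * e - P * q^`())%R + (m - 2) * p.-1 <= N.+1)%N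
}.

(* The form in which [log_frob_lift] enters; [d] is (P^p - P^sigma(X^p)) / p. *)
Definition log_lift_eqs (K : fieldType) (p : nat) (P c d w : {poly K}) : Prop :=
  c * P^`() ^+ p = d + w * P ^+ p /\
  d^`() = P ^+ p.-1 * P^`() - 'X^(p.-1) * P^`() ^+ p.

Section FrobeniusData.
Variables (K : fieldType) (p : nat).
Hypothesis char_K : p \in [pchar K].

(** Differentiating the first relation kills the p-th powers and gives (X^(p-1) + c') P'^p = P^(p-1)
    (P' + w' P). As P is prime to P', the power P^(p-1) divides X^(p-1) + c'; at a root of P the
    quotient satisfies e P'^p = P', which is nonzero. *)
Lemma dlog_frobenius (P c d w : {poly K}) :
  P != 0 -> coprimep P P^`() -> log_lift_eqs p P c d w ->
  exists e, 'X^(p.-1) + c^`() = P ^+ p.-1 * e /\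
            forall z, root P z -> e.[z] != 0.
Proof.
move=> P0 co [H1 H2].
have pE : p = p.-1.+1 by rewrite prednK // prime_gt0 ?(pcharf_prime char_K).
have E : ('X^(p.-1) + c^`()) * P^`() ^+ p = P ^+ p.-1 * (P^`() + w^`() * P).
  have := congr1 (@deriv _) H1; rewrite derivD !derivM !deriv_pth_power //.
  rewrite !mulr0 !addr0 H2 mulrDl => ->.
  by rewrite [in w^`() * _]pE exprSr; ring.
have /dvdpP[e He] : P ^+ p.-1 %| 'X^(p.-1) + c^`().
  rewrite -(@Gauss_dvdpl _ _ (P^`() ^+ p)); first by rewrite E dvdp_mulr.
  exact/coprimep_expl/coprimep_expr.
exists e; split=> [|z Pz]; first by rewrite He mulrC.
have E2 : e * P^`() ^+ p = P^`() + w^`() * P.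
  apply: (mulfI (expf_neq0 p.-1 P0)); rewrite -E He; ring.
have := congr1 (horner^~ z) E2; rewrite !hornerE /= (eqP Pz) mulr0 addr0 => E3.
by apply: contra_eq_neq E3 => ->; rewrite mul0r eq_sym (coprimep_root co).
Qed.

Lemma size_Xderiv_le M (f : {poly K}) :
  (size f <= M.+1)%N -> (size ('X * f^`())%R <= M.+1)%N.
Proof.
move=> sf; apply/leq_sizeP => [[|j]] //; rewrite coefXM /= coef_deriv => jM.
by rewrite nth_default ?mul0rn // (leq_trans sf).
Qed.

(** The relation on U_oo is transported to the variable t by reversal and combined with the one on
    U_0: the terms in [d0] cancel, which makes P^p divide the difference of the two liftings.
    Differentiating the resulting equation for q yields the degree bound. *)
Lemma frobenius_data_exists m (P Q c0 coo d0 doo w0 woo : {poly K}) :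
  (1 < m)%N -> P != 0 -> Q != 0 -> coprimep P P^`() -> coprimep Q Q^`() ->
  (size Q <= m.+1)%N -> revp m Q = P ->
  (size doo <= (p * m).+1)%N -> revp (p * m) doo = d0 ->
  log_lift_eqs p P c0 d0 w0 -> log_lift_eqs p Q coo doo woo ->
  exists N e q, frobenius_data p m P c0 coo N e q.
Proof.
move=> m1 P0 Q0 coP coQ sQ rQ sdoo rdoo H0 Hoo.
have [e [He e0]] := dlog_frobenius P0 coP H0.
have [eoo [Heoo _]] := dlog_frobenius Q0 coQ Hoo.
have p1 : (1 < p)%N by rewrite prime_gt1 ?(pcharf_prime char_K).
pose B := (size coo + size woo + size eoo + m * p + p + 4)%N.
(* [B] is chosen larger than all the degrees that get reversed. As N is a multiple of p, it is 0 in
   K and X^N has zero derivative. *)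
pose N := (p * B)%N.
have BN : (B <= N)%N by rewrite leq_pmull // ltnW.
have pK : p%:R = 0 :> K by rewrite pcharf0.
have NK : N%:R = 0 :> K by rewrite natrM pK mul0r.
have dX k : ('X^(p * k) : {poly K})^`() = 0.
  by rewrite mulnC exprM deriv_pth_power.
have dXN : ('X^N : {poly K})^`() = 0 by exact: dX.
have pN : (p %| N)%N by exact: dvdn_mulr.
clearbody N.
have scoo : (size coo <= N.+1)%N by rewrite /B in BN; lia.
pose G := revp N coo; pose R := revp N ('X^p * woo).
(* This is the relation on U_oo multiplied by X^p and reversed in degree N + p m; the factor X^p
   turns Q' into X Q', whose reversal is m P - X P'. *)
have E1 : G * (m%:R *: P - 'X * P^`()) ^+ p = 'X^(N - p) * d0 + R * P ^+ p.
  have E : coo * ('X * Q^`()) ^+ p = 'X^p * doo + ('X^p * woo) * Q ^+ p.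
    by rewrite exprMn; case: Hoo => Hoo _; rewrite mulrCA Hoo; ring.
  have sX : (size ('X^p : {poly K}) <= N.+1)%N.
    by rewrite size_polyXn ltnS; rewrite /B in BN; lia.
  have sW : (size ('X^p * woo)%R <= N.+1)%N.
    apply: leq_trans (size_polyMleq _ _) _; rewrite size_polyXn.
    by rewrite /B in BN; lia.
  have := congr1 (revp (N + p * m)) E; rewrite revpD !revpM //.
  - rewrite revpXn; last by rewrite /B in BN; lia.
    by rewrite !revpX ?size_Xderiv_le // revpXderiv // rQ rdoo.
  - exact: size_polyX_le.
  - by apply/size_polyX_le/size_Xderiv_le.
(* After multiplication by P'^p the two terms are X^N d0 and - X^N d0 modulo P^p. *)
have [Y EY] : exists Y, ('X^N * c0 + 'X^(2 * p) * G) * P^`() ^+ p = Y * P ^+ p.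
  exists ('X^N * w0 + 'X^p * (m%:R%:P ^+ p * G - R)).
  move: E1; rewrite subr_exprp // -mul_polyC !exprMn => E1.
  have XN : 'X^N = 'X^p * 'X^(N - p) :> {poly K}.
    by rewrite -exprD subnKC //; rewrite /B in BN; lia.
  case: H0 => H0 _; rewrite mulrDl -[_ * c0 * _]mulrA H0 mul2n -addnn exprD.
  have E2 : 'X^p * P^`() ^+ p * G =
      G * (m%:R%:P ^+ p * P ^+ p) - 'X^(N - p) * d0 - R * P ^+ p.
    have -> : 'X^(N - p) * d0 = G * (m%:R%:P ^+ p * P ^+ p - 'X^p * P^`() ^+ p)
        - R * P ^+ p by rewrite E1 addrK.
    by ring.
  have -> : 'X^p * 'X^p * G * P^`() ^+ p = 'X^p * ('X^p * P^`() ^+ p * G) by ring.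
  rewrite E2 XN; ring.
have /dvdpP[q Hq] : P ^+ p %| 'X^N * c0 + 'X^(2 * p) * G.
  rewrite -(@Gauss_dvdpl _ _ (P^`() ^+ p)); first by rewrite EY dvdp_mull.
  exact/coprimep_expl/coprimep_expr.
exists N, e, q; split => //.
- by rewrite /B in BN; lia.
- by rewrite Hq mulrC.
have dG : 'X * G^`() = - revp N.-1 coo^`().
  have := revpXderiv scoo; rewrite NK scale0r sub0r -/G => E.
  rewrite -[LHS]opprK -E; congr (- _).
  have N1 : N = (1 + N.-1)%N by rewrite /B in BN; lia.
  rewrite [in LHS]N1 -['X]expr1 revpXnM ?subnn ?expr0 ?mul1r //.
  have sN : (size coo <= N)%N by rewrite /B in BN; lia.
  rewrite prednK; last by rewrite /B in BN; lia.
  exact: leq_trans (size_poly _ _) (leq_trans (leq_pred _) sN).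
pose M' := (N.-1 - p.-1 * m)%N.
have pm : (p.-1 * m <= m * p)%N by rewrite mulnC leq_mul2l leq_pred orbT.
have NM : N.-1 = (p.-1 * m + M')%N.
  by rewrite subnKC //; rewrite /B in BN; move: (p.-1 * m)%N pm => *; lia.
have sM' : (size eoo <= M'.+1)%N.
  by rewrite /M'; rewrite /B in BN; move: (p.-1 * m)%N pm => *; lia.
(* Multiplied by P^(p-1), the left side loses its two occurrences of X^N c0'; what remains is
   X^(2p-1) times the reversal of X^(p-1) + coo' = Q^(p-1) eoo, and Q reverses to P. *)
have -> : 'X^N * e - P * q^`() = 'X^((2 * p).-1) * revp M' eoo.
  apply: (mulfI (expf_neq0 p.-1 P0)).
  have pE : p = p.-1.+1 by lia.
  have -> : P ^+ p.-1 * ('X^N * e - P * q^`()) =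
      'X^N * (P ^+ p.-1 * e) - P ^+ p * q^`().
    have -> : P ^+ p = P * P ^+ p.-1 by rewrite -exprS -pE.
    by move: (P ^+ p.-1) => Pp; ring.
  have -> : P ^+ p * q^`() = 'X^N * c0^`() - 'X^((2 * p).-1) * revp N.-1 coo^`().
    have := congr1 (@deriv _) Hq; rewrite derivD !derivM (deriv_pth_power P char_K).
    rewrite mulr0 addr0 [q^`() * _]mulrC [(2 * p)%N]mulnC dXN dX !mul0r !add0r => <-.
    congr (_ + _); rewrite -mulrN -dG mulrA -exprSr.
    by congr ('X^_ * _); lia.
  rewrite -He.
  have -> : 'X^N * ('X^(p.-1) + c0^`()) -
     ('X^N * c0^`() - 'X^((2 * p).-1) * revp N.-1 coo^`()) =
     'X^N * 'X^(p.-1) + 'X^((2 * p).-1) * revp N.-1 coo^`() by ring.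
  have -> : 'X^N * 'X^(p.-1) = 'X^((2 * p).-1) * revp N.-1 'X^(p.-1) :> {poly K}.
    rewrite revpXn; last by rewrite /B in BN; lia.
    by rewrite -!exprD; congr ('X^_); rewrite /B in BN; lia.
  rewrite -mulrDr -revpD Heoo {1}NM revpM ?revpX ?rQ //; last exact: size_polyX_le.
  by move: (P ^+ p.-1) ('X^((2 * p).-1)) => *; ring.
have := size_revp M' eoo; have := size_polyMleq ('X^((2 * p).-1)) (revp M' eoo).
rewrite size_polyXn => h1 h2.
have N0 : (0 < N)%N by rewrite /B in BN; lia.
apply: leq_trans (leq_add h1 (leqnn _)) _; move: (size _) h2 => s h2.
have : (m * p.-1 = (m - 2) * p.-1 + 2 * p.-1)%N by rewrite -mulnDl subnK.
rewrite [(m * _)%N]mulnC; move: (p.-1 * m)%N ((m - 2) * p.-1)%N NM => t u NM tu.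
clear -p1 h2 N0 NM tu; clearbody M'; lia.
Qed.

End FrobeniusData.

(** * The Higgs field of the graded bundle *)

(** The coefficient of degree a + b - 1 is (b - a) times the product of the coefficients of degrees
    a and b, hence zero. The proof obtains this from the Euler operator X d/dX - c, which kills
    X^c. *)
Lemma size_wronskian (K : fieldType) a b (f g : {poly K}) :
  (size f <= a.+1)%N -> (size g <= b.+1)%N -> a%:R = b%:R :> K ->
  (size (f * g^`() - f^`() * g)%R <= (a + b).-1)%N.
Proof.
have euler c (h : {poly K}) : (size h <= c.+1)%N ->
    (size ('X * h^`() - c%:R%:P * h)%R <= c)%N.
  move=> sh; apply/leq_sizeP => j cj; rewrite coefB coefXM coefCM coef_deriv.
  have [->|jc] := eqVneq j c; last first.
    rewrite [h`_j]nth_default ?mulr0 ?subr0; last first.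
      by apply: leq_trans sh _; rewrite ltn_neqAle eq_sym jc.
    case: j cj jc => //= j cj jc.
    by rewrite nth_default ?mul0rn //; apply: leq_trans sh _; lia.
  by case: c {cj sh} => [|c] /=; rewrite ?mul0r ?subrr // mulr_natl subrr.
move=> sf sg ab; set w := f * _ - _.
have E : 'X * w = f * ('X * g^`() - b%:R%:P * g) - ('X * f^`() - a%:R%:P * f) * g.
  by rewrite /w ab; ring.
have sw : (size ('X * w)%R <= a + b)%N.
  rewrite E; apply: leq_trans (size_polyD _ _) _; rewrite geq_max size_polyN.
  apply/andP; split; apply: leq_trans (size_polyMleq _ _) _.
    by have := euler _ _ sg; move: (size _) (size _) sf => *; lia.
  by have := euler _ _ sf; move: (size _) (size _) sg => *; lia.
have [->|w0] := eqVneq w 0; first by rewrite size_poly0.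
by move: sw; rewrite mulrC size_mulX //; lia.
Qed.

(* If d = deg f, the coefficient of X^(p d + p - 1) vanishes in g' and not in
   X^(p-1) f^p. *)
Lemma Xp1_pth_power_not_deriv (p : nat) (K : fieldType) (f g : {poly K}) :
  p \in [pchar K] -> g^`() = 'X^(p.-1) * f ^+ p -> f = 0.
Proof.
move=> chp E; apply/eqP; apply: contraT => f0.
have p0 : (0 < p)%N by rewrite prime_gt0 ?(pcharf_prime chp).
have := congr1 (fun h : {poly K} => h`_((size f).-1 * p + p.-1)) E.
rewrite coef_deriv coefXnM ifN -?leqNgt ?leq_addl // addnK -addnS prednK //.
rewrite -mulr_natr -mulSnr natrM (pcharf0 chp) !mulr0.
have := lead_coef_exp f p; rewrite {1}lead_coefE size_exp => ->.
by move/esym/eqP; rewrite expf_eq0 p0 lead_coef_eq0 (negPf f0).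
Qed.

Section HodgeFiltration.
Variables (K : fieldType) (p m : nat) (P c0 coo : {poly K}).
Variables (N : nat) (e q : {poly K}).
Hypothesis char_K : p \in [pchar K].
Hypothesis p_odd : odd p.
Hypothesis m_gt2 : (2 < m)%N.
Hypothesis size_P : (size P <= m.+1)%N.
Hypothesis FD : frobenius_data p m P c0 coo N e q.

Implicit Types s a : {poly K}.
Local Notation r := (p.-1./2).

(* (a, second_coord s a) is a section of V over U_0, in the frame F^*e_0. *)
Definition second_coord (s a : {poly K}) : {poly K} :=
  - drop_poly N (q * s ^+ p * a).

(** Divided by t^N, this is the second coordinate of the same section in the frame F^*e_oo. The
    section defines a map O(r + 1) -> V when a has degree at most r and this polynomial has size at
    most N - r. *)
Definition second_coord_oo (s a : {poly K}) : {poly K} :=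
  take_poly N (q * s ^+ p * a).

(* P times the lower left entry of the connection of V in a frame of determinant
   1 whose first vector is (a, b). *)
Definition gr_field (s a : {poly K}) : {poly K} :=
  let b := second_coord s a in
  P * (a * b^`() - a^`() * b) + a ^+ 2 * e * s ^+ p.

Lemma second_coordE s a :
  'X^N * second_coord s a = second_coord_oo s a - q * s ^+ p * a.
Proof.
rewrite /second_coord /second_coord_oo -[X in _ = _ - X](poly_take_drop N).
by ring.
Qed.

Lemma gr_field_root s a z : root P z ->
  (gr_field s a).[z] = a.[z] ^+ 2 * e.[z] * s.[z] ^+ p.
Proof. by move=> /eqP Pz; rewrite /gr_field !hornerE Pz mul0r add0r. Qed.

Lemma half_p : p = r.*2.+1.
Proof.
have := odd_double_half p; rewrite p_odd => {1}<-.
by rewrite -{2}(odd_double_half p) p_odd /= add1n /= doubleK.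
Qed.

(** If the field vanished, then for g = P^p b + c0 s^p a the quotient g / a would have derivative -
    X^(p-1) s^p. Multiplying by the p-th power - a^p, which is a constant for d/dX up to sign,
    X^(p-1) (a s)^p would be the derivative of a polynomial. *)
Lemma gr_field_neq0 s a : s != 0 -> a != 0 -> gr_field s a != 0.
Proof.
move=> s0 a0; apply/eqP; rewrite /gr_field; set b := second_coord s a => E.
have p2 : p = p.-2.+2.
  by move: p_odd (prime_gt1 (pcharf_prime char_K)); case: (p) => [|[]].
pose g := P ^+ p * b + c0 * s ^+ p * a.
have Eg : a * g^`() - a^`() * g = - (a ^+ 2 * s ^+ p * 'X^(p.-1)).
  have -> : a * g^`() - a^`() * g =
      P ^+ p * (a * b^`() - a^`() * b) + a ^+ 2 * c0^`() * s ^+ p.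
    rewrite /g !derivD !derivM !deriv_pth_power //.
    by move: (P ^+ p) (s ^+ p) => P' s'; ring.
  have PE : P ^+ p = P ^+ p.-1 * P by rewrite -exprSr p2.
  have {E}E : P * (a * b^`() - a^`() * b) = - (a ^+ 2 * e * s ^+ p).
    by apply/eqP; rewrite -addr_eq0 E.
  rewrite PE -mulrA E -[c0^`()](addKr 'X^(p.-1)) (fd_e FD).
  by move: (s ^+ p) (P ^+ p.-1) ('X^(p.-1)) => s' P' X'; ring.
have : (- (g * a ^+ p.-1))^`() = 'X^(p.-1) * (a * s) ^+ p.
  have da : (a ^+ p.-1)^`() = - (a ^+ p.-2 * a^`()).
    have p1 : p.-1%:R = -1 :> {poly K}.
      apply/eqP; rewrite -addr_eq0 natr1 prednK ?prime_gt0 ?(pcharf_prime char_K) //.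
      by rewrite -polyC_natr (pcharf0 char_K).
    by rewrite deriv_exp -mulr_natr p1 mulrN1 mulrC.
  rewrite derivN derivM da.
  have -> : a ^+ p.-1 = a * a ^+ p.-2 by rewrite -exprS p2.
  have -> : - (g^`() * (a * a ^+ p.-2) + g * - (a ^+ p.-2 * a^`())) =
     - (a ^+ p.-2 * (a * g^`() - a^`() * g)).
    by move: (a ^+ p.-2) => a'; ring.
  rewrite Eg exprMn [a ^+ p](_ : _ = a ^+ p.-2 * a ^+ 2); last first.
    by rewrite -exprD addn2 -p2.
  by move: (s ^+ p) (a ^+ p.-2) ('X^(p.-1)) => s' a' X'; ring.
move/(Xp1_pth_power_not_deriv char_K)/eqP; rewrite mulf_eq0.
by rewrite (negPf s0) (negPf a0).
Qed.

(** Multiplied by X^N, the field becomes P (a w' - a' w) + a^2 (X^N e - P q') s^p, where w replaces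
    b and has bounded degree. [size_wronskian] applies because N - (r + 1) = r in K, and [fd_size]
    controls the second term. *)
Lemma size_gr_field s a : (size s <= m - 2)%N -> (size a <= r.+1)%N ->
  (size (second_coord_oo s a) <= N - r)%N -> (size (gr_field s a) <= m - 2)%N.
Proof.
move=> ss sa; rewrite /gr_field; have := second_coordE s a.
set b := second_coord s a; set w := second_coord_oo s a => Eb sw.
have dXN : ('X^N : {poly K})^`() = 0.
  by have /dvdnP[k ->] := fd_pdivN FD; rewrite exprM deriv_pth_power.
have Eb' : 'X^N * b^`() = w^`() - q^`() * s ^+ p * a - q * s ^+ p * a^`().
  have := congr1 (@deriv _) Eb.
  rewrite derivB !derivM dXN deriv_pth_power // mul0r add0r mulr0 addr0 => ->.
  by ring.
have rN : (r < N)%N by apply: leq_trans (fd_leN FD); rewrite {2}half_p; lia.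
have E : 'X^N * (P * (a * b^`() - a^`() * b) + a ^+ 2 * e * s ^+ p) =
   P * (a * w^`() - a^`() * w) + a ^+ 2 * ('X^N * e - P * q^`()) * s ^+ p.
  have -> : 'X^N * (P * (a * b^`() - a^`() * b) + a ^+ 2 * e * s ^+ p) =
     P * (a * ('X^N * b^`()) - a^`() * ('X^N * b)) + a ^+ 2 * ('X^N * e) * s ^+ p.
    by move: (s ^+ p) ('X^N) => s' X'; ring.
  by rewrite Eb Eb'; move: (s ^+ p) ('X^N) => s' X'; ring.
have sE : (size ('X^N * (P * (a * b^`() - a^`() * b) + a ^+ 2 * e * s ^+ p))%R
            <= N + (m - 2))%N.
  rewrite E; apply: leq_trans (size_polyD _ _) _; rewrite geq_max.
  apply/andP; split.
    have sw' : (size w <= (N - r.+1).+1)%N by rewrite subnSK.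
    have := @size_wronskian K r (N - r.+1) a w sa sw'.
    rewrite natrB // => /(_ _)h; apply: leq_trans (size_polyMleq _ _) _.
    have {h} : (size (a * w^`() - a^`() * w)%R <= (r + (N - r.+1)).-1)%N.
      apply: h; apply/eqP; rewrite eq_sym subr_eq -natrD addnS addnn -half_p.
      have /dvdnP[k ->] := fd_pdivN FD.
      by rewrite natrM (pcharf0 char_K) mulr0.
    have := fd_leN FD; have := prime_gt1 (pcharf_prime char_K).
    move: (size _) (size _) size_P => u v; lia.
  have := fd_size FD; move: (_ - _ * q^`()) => z sz.
  have [->|z0] := eqVneq z 0; first by rewrite mulr0 mul0r size_poly0.
  rewrite -size_poly_gt0 in z0; apply: leq_trans (size_polyMleq _ _) _.
  have s1 : (size (a ^+ 2 * z)%R <= (2 * r + (size z).-1).+1)%N.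
    apply: size_polyM_le; first exact: size_polyX_le.
    by rewrite -ltnS; case: (size z).
  have s2 : (size (s ^+ p)%R <= (p * (m - 2).-1).+1)%N.
    by apply: size_polyX_le; rewrite prednK // subn_gt0.
  have e1 : (p * (m - 2).-1 + p = (m - 2) * p.-1 + (m - 2))%N.
    have := prime_gt0 (pcharf_prime char_K); case: (p) => // p' _.
    have : (0 < m - 2)%N by rewrite subn_gt0.
    by case: (m - 2)%N => // m' _ /=; ring.
  have := half_p.
  move: (size _) (size _) (size _) s2 sz s1 z0 => u v t.
  move: (p * _)%N ((m - 2) * _)%N e1 => A B e1; lia.
move: sE; set o := P * _ + _ => sE.
have [->|o0] := eqVneq o 0; first by rewrite size_poly0.
by move: sE; rewrite mulrC size_mulXn // leq_add2l.
Qed.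

(** Otherwise the new field would vanish at all n points, at [z i] through a and at the others
    through s, although it is nonzero of size at most n. *)
Lemma hodge_filtration_nonvanishing n (z : 'I_n -> K) (i : 'I_n) s a :
  n = (m - 2)%N -> injective z -> (forall j, root P (z j)) ->
  s != 0 -> (size s <= m - 2)%N -> (forall j, j != i -> s.[z j] = 0) ->
  a != 0 -> (size a <= r.+1)%N -> (size (second_coord_oo s a) <= N - r)%N ->
  a.[z i] != 0.
Proof.
move=> nm zi Pz s0 ss sz a0 sa sw; apply/eqP => az.
have /eqP := gr_field_neq0 s0 a0; apply.
apply: (@roots_geq_poly_eq0 _ _ [seq z j | j <- enum 'I_n]).
- apply/allP => _ /mapP[j _ ->]; rewrite /root gr_field_root //.
  have [->|/sz ->] := eqVneq j i; first by rewrite az expr0n mul0r mul0r.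
  by rewrite expr0n eqn0Ngt prime_gt0 ?(pcharf_prime char_K) // mulr0.
- by rewrite map_inj_uniq // enum_uniq.
by rewrite size_map size_enum_ord nm size_gr_field.
Qed.

End HodgeFiltration.

(** * Pade approximation and interpolation *)

(** Applied to the coefficients of a polynomial a of size at most r + 1, row 0 gives a(z) and row i
    > 0 gives the coefficient of X^(N-i) in F a. *)
Definition hankel (K : comNzRingType) (r N : nat) (F : {poly K}) (z : K) :
    'M[K]_r.+1 :=
  \matrix_(i, l) if i == ord0 then z ^+ l else F`_(N - i - l).

(* det (hankel r N F X), expanded along its first row; the argument 0 of the
   cofactors is irrelevant. *)
Definition pade_denom (K : comNzRingType) (r N : nat) (F : {poly K}) : {poly K} :=
  \poly_(l < r.+1) cofactor (hankel r N F 0) ord0 (inord l).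

Lemma size_take_polyP (K : nzRingType) (M h : nat) (F : {poly K}) : (h <= M)%N ->
  (size (take_poly M F) <= M - h)%N <->
  (forall i, (0 < i <= h)%N -> F`_(M - i) = 0).
Proof.
move=> hM; split=> [H i /andP[i0 ih]|H].
  have := nth_default 0 (leq_trans H (leq_sub2l M ih)).
  by rewrite coef_take_poly ifT //; lia.
apply/leq_sizeP => j jM; rewrite coef_take_poly; case: ltnP => // jM'.
by rewrite -(subKn (ltnW jM')) H //; lia.
Qed.

Section Pade.
Variables (K : fieldType) (r N : nat).
Hypothesis rN : (2 * r <= N)%N.
Implicit Types F a : {poly K}.

Lemma cofactor_hankel F z l :
  cofactor (hankel r N F z) ord0 l = cofactor (hankel r N F 0) ord0 l.
Proof.
rewrite /cofactor; congr (_ * \det _); apply/matrixP => i j.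
by rewrite !mxE.
Qed.

Lemma size_pade_denom F : (size (pade_denom r N F) <= r.+1)%N.
Proof. exact: size_poly. Qed.

Lemma coef_pade_denom F (l : 'I_r.+1) :
  (pade_denom r N F)`_l = cofactor (hankel r N F 0) ord0 l.
Proof. by rewrite coef_poly ltn_ord inord_val. Qed.

Lemma pade_denomE F z : (pade_denom r N F).[z] = \det (hankel r N F z).
Proof.
rewrite (expand_det_row _ ord0) (horner_coef_wide _ (size_pade_denom F)).
apply: eq_bigr => l _; rewrite coef_pade_denom -(cofactor_hankel F z) mxE eqxx.
by rewrite mulrC.
Qed.

Lemma horner_row F z a : (size a <= r.+1)%N ->
  \sum_(l < r.+1) hankel r N F z ord0 l * a`_l = a.[z].
Proof.
move=> sa; rewrite (horner_coef_wide _ sa); apply: eq_bigr => l _.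
by rewrite mxE eqxx mulrC.
Qed.

Lemma coefM_row F z a (i : 'I_r.+1) : (size a <= r.+1)%N -> i != ord0 ->
  \sum_(l < r.+1) hankel r N F z i l * a`_l = (F * a)`_(N - i).
Proof.
move=> sa i0; rewrite mulrC coefM.
have iN : (r <= N - i)%N by have := ltn_ord i; lia.
rewrite -(big_mkord xpredT (fun l => a`_l * F`_(N - i - l))).
rewrite (big_cat_nat (n := r.+1)) //=; rewrite [X in _ + X]big_nat_cond [X in _ + X]big1 ?addr0 => [|l].
  rewrite big_mkord; apply: eq_bigr => l _.
  by rewrite mxE (negPf i0) mulrC.
by case/andP => /andP[rl _] _; rewrite nth_default ?mul0r // (leq_trans sa).
Qed.

(** The coefficients of the denominator are the cofactors of row 0, that is, column 0 of the
    adjugate; every other row of the matrix is orthogonal to it. *)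
Lemma size_take_pade_denom F :
  (size (take_poly N (F * pade_denom r N F)) <= N - r)%N.
Proof.
apply/size_take_polyP; first by lia.
move=> i /andP[i0 ir].
have ri : (i < r.+1)%N by [].
have ne : Ordinal ri != ord0 by rewrite -val_eqE /= -lt0n.
have <- := coefM_row F 0 (size_pade_denom F) ne.
set T := hankel r N F 0.
have E : \sum_(l < r.+1) T (Ordinal ri) l * (\adj T) l ord0 = 0.
  by have /matrixP/(_ (Ordinal ri) ord0) := mul_mx_adj T; rewrite !mxE (negPf ne).
rewrite -[RHS]E; apply: eq_bigr => l _.
by rewrite coef_pade_denom !mxE.
Qed.

(** A kernel vector of the matrix is the coefficient vector of a nonzero approximant that vanishes
    at z. *)
Lemma det_hankel_neq0 F z :
  (forall a, a != 0 -> (size a <= r.+1)%N ->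
     (size (take_poly N (F * a)) <= N - r)%N -> a.[z] != 0) ->
  \det (hankel r N F z) != 0.
Proof.
move=> H; rewrite -det_tr; apply/det0P => -[v v0 Hv].
pose a : {poly K} := \poly_(l < r.+1) v ord0 (inord l).
have sa : (size a <= r.+1)%N by exact: size_poly.
have row i : \sum_(l < r.+1) hankel r N F z i l * a`_l = 0.
  move/rowP/(_ i): Hv; rewrite !mxE => E; rewrite -[RHS]E; apply: eq_bigr => l _.
  by rewrite [_^T _ _]mxE coef_poly ltn_ord inord_val mulrC.
have a0 : a != 0.
  apply: contraNneq v0 => a0; apply/eqP/rowP => l; rewrite [RHS]mxE.
  by have := congr1 (fun h : {poly K} => h`_l) a0;
     rewrite coef_poly ltn_ord inord_val coef0.
suff sW : (size (take_poly N (F * a)) <= N - r)%N.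
  by have := H a a0 sa sW; rewrite -(horner_row F z sa) row eqxx.
apply/size_take_polyP => [|i /andP[i0 ir]]; first by lia.
have ri : (i < r.+1)%N by [].
have ne : Ordinal ri != ord0 by rewrite -val_eqE /= -lt0n.
by rewrite -(coefM_row F z sa ne) row.
Qed.

(** Prescribing the coefficients of F a is what later produces the second vector of a frame of V. *)
Lemma hankel_solve F z (c : nat -> K) : \det (hankel r N F z) != 0 ->
  exists a, [/\ (size a <= r.+1)%N, a.[z] = 0
    & forall i, (0 < i <= r)%N -> (F * a)`_(N - i) = c i].
Proof.
move=> d0; pose rhs : 'cV[K]_r.+1 := \col_i (if i == ord0 then 0 else c i).
have uT : hankel r N F z \in unitmx by rewrite unitmxE unitfE.
pose v := invmx (hankel r N F z) *m rhs.
have Hv : hankel r N F z *m v = rhs by rewrite /v mulmxA mulmxV // mul1mx.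
pose a : {poly K} := \poly_(l < r.+1) v (inord l) ord0.
have sa : (size a <= r.+1)%N by exact: size_poly.
have row i : \sum_(l < r.+1) hankel r N F z i l * a`_l = rhs i ord0.
  rewrite -Hv mxE; apply: eq_bigr => l _.
  by rewrite coef_poly ltn_ord inord_val.
exists a; split=> //; first by rewrite -(horner_row F z sa) row mxE eqxx.
move=> i /andP[i0 ir]; have ri : (i < r.+1)%N by [].
have ne : Ordinal ri != ord0 by rewrite -val_eqE /= -lt0n.
by rewrite -(coefM_row F z sa ne) row mxE (negPf ne).
Qed.

End Pade.

Section Lagrange.
Variables (K : fieldType) (n : nat) (z : 'I_n -> K).
Hypothesis z_inj : injective z.

Definition lagrange_basis (i : 'I_n) : {poly K} :=
  (\prod_(j | j != i) (z i - z j))^-1 *: \prod_(j | j != i) ('X - (z j)%:P).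

Lemma lagrange_basisE i j : (lagrange_basis i).[z j] = (i == j)%:R.
Proof.
rewrite hornerZ horner_prod; have [->|ij] := eqVneq i j.
  rewrite [X in _ * X](eq_bigr (fun k => z j - z k)) ?mulVf //.
    by apply/prodf_neq0 => k kj; rewrite subr_eq0; apply: contraNneq kj => /z_inj ->.
  by move=> k _; rewrite !hornerE.
have /eqP -> : \prod_(k | k != i) ('X - (z k)%:P).[z j] == 0.
  by apply/prodf_eq0; exists j; rewrite 1?eq_sym // !hornerE subrr.
by rewrite mulr0.
Qed.

Lemma size_lagrange_basis i : (size (lagrange_basis i) <= n)%N.
Proof.
apply: leq_trans (size_scale_leq _ _) _.
rewrite size_prod => [|j _]; last by rewrite polyXsubC_eq0.
rewrite (eq_bigr (fun=> 2%N)) => [|j _]; last by rewrite size_XsubC.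
rewrite sum_nat_const.
have := cardC1 i; rewrite card_ord -(eq_card (A := fun j => j != i)) // => ->.
by have := ltn_ord i; lia.
Qed.

Lemma lagrange_interpolation (h : {poly K}) : (size h <= n)%N ->
  h = \sum_i h.[z i] *: lagrange_basis i.
Proof.
move=> sh; apply/eqP; rewrite -subr_eq0; apply/eqP.
apply: (@roots_geq_poly_eq0 _ _ [seq z j | j <- enum 'I_n]).
- apply/allP => _ /mapP[j _ ->]; rewrite /root hornerD hornerN horner_sum.
  rewrite (bigD1 j) //= big1 => [|i ij]; last first.
    by rewrite hornerZ lagrange_basisE (negPf ij) mulr0.
  by rewrite hornerZ lagrange_basisE eqxx mulr1 addr0 subrr.
- by rewrite map_inj_uniq // enum_uniq.
rewrite size_map size_enum_ord; apply: leq_trans (size_polyD _ _) _.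
rewrite geq_max sh size_polyN; apply: leq_trans (size_sum _ _ _) _.
apply/bigmax_leqP => i _.
exact: leq_trans (size_scale_leq _ _) (size_lagrange_basis i).
Qed.

End Lagrange.

(** * Generic points *)

Section CoefPolyOnLines.
Variables (K : comNzRingType) (n : nat).
Implicit Types F G : ('I_n -> K) -> {poly K}.

Definition coefs_poly_on_lines F : Prop :=
  forall i, poly_on_lines (fun w => (F w)`_i).

Lemma coefs_poly_on_linesM F G : coefs_poly_on_lines F ->
  coefs_poly_on_lines G -> coefs_poly_on_lines (fun w => F w * G w).
Proof.
move=> HF HG i; apply: (@eq_poly_on_lines _ _
  (fun w => \sum_(j < i.+1) (F w)`_j * (G w)`_(i - j))).
  by move=> w; rewrite coefM.
by apply: poly_on_lines_sum => j; apply: poly_on_linesM.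
Qed.

Lemma coefs_poly_on_linesD F G : coefs_poly_on_lines F ->
  coefs_poly_on_lines G -> coefs_poly_on_lines (fun w => F w + G w).
Proof.
move=> HF HG i; apply: eq_poly_on_lines (poly_on_linesD (HF i) (HG i)) => w.
by rewrite coefD.
Qed.

Lemma coefs_poly_on_linesN F :
  coefs_poly_on_lines F -> coefs_poly_on_lines (fun w => - F w).
Proof.
move=> HF i; apply: eq_poly_on_lines (poly_on_linesN (HF i)) => w.
by rewrite coefN.
Qed.

Lemma coefs_poly_on_lines_cst f : coefs_poly_on_lines (fun _ : 'I_n -> K => f).
Proof. by move=> i; apply: poly_on_lines_cst. Qed.

Lemma coefs_poly_on_linesX F k :
  coefs_poly_on_lines F -> coefs_poly_on_lines (fun w => F w ^+ k).
Proof.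
move=> HF; elim: k => [|k IH] i.
  exact: eq_poly_on_lines (@poly_on_lines_cst _ _ (1 : {poly K})`_i).
by apply: eq_poly_on_lines (coefs_poly_on_linesM HF IH i) => w; rewrite exprS.
Qed.

Lemma coefs_poly_on_lines_deriv F :
  coefs_poly_on_lines F -> coefs_poly_on_lines (fun w => (F w)^`()).
Proof.
move=> HF i; apply: (@eq_poly_on_lines _ _ (fun w => i.+1%:R * (F w)`_i.+1)).
  by move=> w; rewrite coef_deriv mulr_natl.
by apply: poly_on_linesM => //; apply: poly_on_lines_cst.
Qed.

Lemma coefs_poly_on_lines_drop F k :
  coefs_poly_on_lines F -> coefs_poly_on_lines (fun w => drop_poly k (F w)).
Proof.
move=> HF i; apply: eq_poly_on_lines (HF (i + k)%N) => w.
by rewrite coef_drop_poly.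
Qed.

Lemma poly_on_lines_hankel r N F z : coefs_poly_on_lines F ->
  forall i j, poly_on_lines (fun w => hankel r N (F w) z i j).
Proof.
move=> HF i j; apply: (@eq_poly_on_lines _ _
  (fun w => if i == ord0 then z ^+ j else (F w)`_(N - i - j))).
  by move=> w; rewrite mxE.
by case: (i == ord0); [apply: poly_on_lines_cst | apply: HF].
Qed.

Lemma coefs_poly_on_lines_pade_denom r N F : coefs_poly_on_lines F ->
  coefs_poly_on_lines (fun w => pade_denom r N (F w)).
Proof.
move=> HF i; apply: (@eq_poly_on_lines _ _ (fun w =>
  if (i < r.+1)%N then cofactor (hankel r N (F w) 0) ord0 (inord i) else 0)).
  by move=> w; rewrite coef_poly.
case: (i < r.+1)%N; last exact: poly_on_lines_cst.
apply: poly_on_linesM; first exact: poly_on_lines_cst.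
apply: poly_on_lines_det => j k.
apply: (@eq_poly_on_lines _ _ (fun w =>
  hankel r N (F w) 0 (lift ord0 j) (lift (inord i) k))).
  by move=> w; rewrite !mxE.
exact: poly_on_lines_hankel.
Qed.

Definition coords_poly (w : 'I_n -> K) : {poly K} := \sum_(i < n) w i *: 'X^i.

Lemma coords_polyE w :
  coords_poly w = \poly_(i < n) (if insub i is Some j then w j else 0).
Proof.
by rewrite poly_def; apply: eq_bigr => i _; rewrite valK.
Qed.

Lemma coef_coords_poly w (i : 'I_n) : (coords_poly w)`_i = w i.
Proof. by rewrite coords_polyE coef_poly ltn_ord valK. Qed.

Lemma size_coords_poly w : (size (coords_poly w) <= n)%N.
Proof. by rewrite coords_polyE size_poly. Qed.

Lemma coords_polyK (f : {poly K}) (w : 'I_n -> K) : (size f <= n)%N ->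
  (forall i : 'I_n, w i = f`_i) -> coords_poly w = f.
Proof.
move=> sf wf; apply/polyP => i; have [h|h] := ltnP i n.
  by rewrite (coef_coords_poly w (Ordinal h)) wf.
by rewrite !nth_default // (leq_trans _ h) // size_coords_poly.
Qed.

Lemma coefs_poly_on_lines_coords : coefs_poly_on_lines coords_poly.
Proof.
move=> i; have [h|h] := ltnP i n.
  apply: eq_poly_on_lines (@poly_on_lines_coord _ _ (Ordinal h)) => w.
  by rewrite (coef_coords_poly w (Ordinal h)).
apply: eq_poly_on_lines (@poly_on_lines_cst _ _ 0) => w.
by rewrite nth_default // (leq_trans _ h) // size_coords_poly.
Qed.

End CoefPolyOnLines.

Section GenericPoint.
Variables (K : closedFieldType) (p m : nat) (P c0 coo : {poly K}).
Variables (N : nat) (e q : {poly K}).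
Hypothesis char_K : p \in [pchar K].
Hypothesis p_odd : odd p.
Hypothesis m_gt3 : (3 < m)%N.
Hypothesis size_P : (size P <= m.+1)%N.
Hypothesis FD : frobenius_data p m P c0 coo N e q.
Local Notation n := (m - 2)%N.
Variable z : 'I_n -> K.
Hypothesis z_inj : injective z.
Hypothesis z_root : forall i, root P (z i).
Local Notation r := (p.-1./2).

(** First coordinate of the map O(r + 1) -> V; by [pade_denomE] its value at a point is a Hankel
    determinant. *)
Definition hodge_denom (s : {poly K}) : {poly K} :=
  pade_denom r N (q * s ^+ p).

Lemma double_half_le : (2 * r <= N)%N.
Proof.
by apply: leq_trans (fd_leN FD); rewrite mul2n {2}(half_p p_odd); apply: leqnSn.
Qed.

Lemma half_p_gt0 : (0 < r)%N.
Proof.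
have := prime_gt1 (pcharf_prime char_K); rewrite {1}(half_p p_odd).
by case: (r).
Qed.

Lemma hodge_denom_basis i s : s = lagrange_basis z i -> (hodge_denom s).[z i] != 0.
Proof.
move=> sE; rewrite /hodge_denom pade_denomE.
have s0 : s != 0.
  apply/eqP => s0; have /eqP := lagrange_basisE z_inj i i.
  by rewrite -sE s0 horner0 eqxx eq_sym oner_eq0.
apply: det_hankel_neq0; first exact: double_half_le.
move=> a a0 sa sw; have m2 : (2 < m)%N by exact: ltnW.
apply: (hodge_filtration_nonvanishing char_K p_odd m2 size_P FD (n := n) (s := s)) => //.
  by rewrite sE size_lagrange_basis.
by move=> j ji; rewrite sE lagrange_basisE // eq_sym (negPf ji).
Qed.

(** For s = 0 every product F a is zero, whereas [hankel_solve] would give one with coefficient 1 at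
    X^(N-1), an index in range because r > 0. *)
Lemma det_hankel0_neq0 x s : \det (hankel r N (q * s ^+ p) x) != 0 -> s != 0.
Proof.
move=> d; apply: contraNneq (oner_neq0 K) => s0; apply/eqP.
have [a [_ _ /(_ 1%N)]] := hankel_solve double_half_le (fun=> 1) d.
rewrite half_p_gt0 => /(_ erefl) <-; rewrite s0 expr0n eqn0Ngt.
by rewrite prime_gt0 ?(pcharf_prime char_K) //= mulr0 mul0r coef0.
Qed.

(** Three open conditions are to hold at once: the source condition g, the splitting of V as O(r +
    1) + O(r), and the target condition f at the image. Each is shown to hold somewhere, and they
    are then combined along two lines. *)
Lemma generic_point (f g : {mpoly K[n]}) : f != 0 -> g != 0 ->
  exists (v : 'I_n -> K) (i : 'I_n), let s := coords_poly v in
    [/\ g.@[v] != 0, \det (hankel r N (q * s ^+ p) (z i)) != 0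
      & f.@[fun k => (gr_field p P N e q s (hodge_denom s))`_k] != 0].
Proof.
move=> f0 g0; have m2 : (2 < m)%N by exact: ltnW.
(* [c] passes from the values y_i = s(z_i) to the coefficients of s, and [fc] below is f written in
   terms of values. *)
pose c (y : 'I_n -> K) (k : 'I_n) := \sum_i y i * (lagrange_basis z i)`_k.
have cE y : coords_poly (c y) = \sum_i y i *: lagrange_basis z i.
  apply: coords_polyK => [|k].
    apply: leq_trans (size_sum _ _ _) _; apply/bigmax_leqP => i _.
    exact: leq_trans (size_scale_leq _ _) (size_lagrange_basis z i).
  by rewrite coef_sum; apply: eq_bigr => i _; apply/esym/coefZ.
have interp (h : {poly K}) k : (size h <= n)%N -> c (fun i => h.[z i]) k = h`_k.
  move=> sh; rewrite [in RHS](lagrange_interpolation z_inj sh) coef_sum.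
  by apply: eq_bigr => i _; apply/esym/coefZ.
have cz y i : (coords_poly (c y)).[z i] = y i.
  rewrite cE horner_sum (bigD1 i) //= big1 => [|j ji].
    by rewrite hornerZ lagrange_basisE // eqxx mulr1 addr0.
  by rewrite hornerZ lagrange_basisE // (negPf ji) mulr0.
pose fc := f \mPo [tuple \sum_i (lagrange_basis z i)`_k *: 'X_i | k < n].
have fcE y : fc.@[y] = f.@[c y].
  rewrite comp_mpoly_meval; apply: meval_eq => k; rewrite tnth_mktuple.
  rewrite rmorph_sum; apply: eq_bigr => i _ /=.
  by rewrite mevalZ mevalXU mulrC.
have fc0 : fc != 0.
  have [v Hv] := mpoly_nonvanishing f0; apply: contraNneq Hv => fc0.
  have := fcE (fun i => (coords_poly v).[z i]); rewrite fc0 meval0 => ->.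
  apply/eqP/meval_eq => k; rewrite interp ?size_coords_poly //.
  by rewrite coef_coords_poly.
pose grf (w : 'I_n -> K) := gr_field p P N e q (coords_poly w) (hodge_denom (coords_poly w)).
have PS : coefs_poly_on_lines (fun w : 'I_n -> K => q * coords_poly w ^+ p).
  apply: coefs_poly_on_linesM; first exact: coefs_poly_on_lines_cst.
  exact/coefs_poly_on_linesX/coefs_poly_on_lines_coords.
have PD i : poly_on_lines (fun w : 'I_n -> K =>
    \det (hankel r N (q * coords_poly w ^+ p) (z i))).
  apply: poly_on_lines_det => j k.
  exact: (@poly_on_lines_hankel _ _ r N _ (z i) PS).
have PA : coefs_poly_on_lines (fun w : 'I_n -> K => hodge_denom (coords_poly w)).
  exact: (@coefs_poly_on_lines_pade_denom _ _ r N _ PS).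
have PB : coefs_poly_on_lines
    (fun w : 'I_n -> K => second_coord p N q (coords_poly w) (hodge_denom (coords_poly w))).
  by apply/coefs_poly_on_linesN/coefs_poly_on_lines_drop/coefs_poly_on_linesM.
have PG : coefs_poly_on_lines grf.
  apply: coefs_poly_on_linesD; apply: coefs_poly_on_linesM.
  - exact: coefs_poly_on_lines_cst.
  - apply: coefs_poly_on_linesD; last apply: coefs_poly_on_linesN;
      by apply: coefs_poly_on_linesM => //; apply: coefs_poly_on_lines_deriv.
  - apply: coefs_poly_on_linesM; last exact: coefs_poly_on_lines_cst.
    exact: coefs_poly_on_linesX.
  - exact/coefs_poly_on_linesX/coefs_poly_on_lines_coords.
have [y Hy] : exists y, f.@[fun k => (grf (c y))`_k] != 0.
  (* At [z i] the new field has the value H_i(y) y_i^p, with H_i the square of the Hankel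
     determinant times e(z_i). *)
  have [||||y Hy] := @triangular_map_nonvanishing K n p
    (fun i y => \det (hankel r N (q * coords_poly (c y) ^+ p) (z i)) ^+ 2 * e.[z i]) fc.
  - by rewrite prime_gt0 // (pcharf_prime char_K).
  - move=> i; apply: poly_on_linesM; last exact: poly_on_lines_cst.
    apply: poly_on_linesX.
    exact: (poly_on_lines_comp_lin (fun k i => (lagrange_basis z i)`_k) (PD i)).
  - move=> i w Hw; apply: mulf_neq0; last exact: (fd_e_neq0 FD).
    apply: expf_neq0; rewrite -pade_denomE; apply: hodge_denom_basis.
    rewrite cE (bigD1 i) //= Hw eqxx scale1r big1 ?addr0 // => j ji.
    by rewrite Hw (negPf ji) scale0r.
  - exact: fc0.
  exists y; move: Hy; rewrite fcE; congr (_ != 0); apply: meval_eq => k.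
  (* The new field has size at most n, so its coefficients are recovered from its values at the
     points [z i]. *)
  rewrite -(interp (grf (c y))); last first.
    apply: (size_gr_field char_K p_odd m2 size_P FD).
    - exact: size_coords_poly.
    - exact: size_pade_denom.
    - by apply: size_take_pade_denom; apply: double_half_le.
  apply: eq_bigr => i _; congr (_ * _); rewrite /grf gr_field_root //.
  by rewrite cz /hodge_denom pade_denomE.
have n0 : (0 < n)%N by rewrite subn_gt0 ltnW.
pose i0 := Ordinal n0.
have Hd : \det (hankel r N
    (q * coords_poly (fun k : 'I_n => (lagrange_basis z i0)`_k) ^+ p) (z i0)) != 0.
  rewrite -pade_denomE; apply: hodge_denom_basis.
  by apply: coords_polyK => //; apply: size_lagrange_basis.
have PF : poly_on_lines (fun w : 'I_n -> K => f.@[fun k => (grf w)`_k]).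
  by apply: poly_on_lines_meval => i; apply: PG.
have [t1 Ht1] := poly_on_lines_nonzero_both PF (PD i0) Hy Hd.
pose w1 (i : 'I_n) := c y i + t1 * ((lagrange_basis z i0)`_i - c y i).
have [//|h1 h2] := Ht1 w1.
have PFD := poly_on_linesM PF (PD i0).
have [v Hv] := mpoly_nonvanishing g0.
have Pg : poly_on_lines (fun w : 'I_n -> K => g.@[w]).
  by apply: poly_on_lines_meval => i; apply: poly_on_lines_coord.
have [t2 Ht2] := poly_on_lines_nonzero_both PFD Pg (mulf_neq0 h1 h2) Hv.
have [//|h3 h4] := Ht2 (fun i => w1 i + t2 * (v i - w1 i)).
move: h3; rewrite mulf_eq0 => /norP[h3 h5].
exists (fun i => w1 i + t2 * (v i - w1 i)), i0.
by split; [exact: h4 | exact: h5 | exact: h3].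
Qed.

End GenericPoint.

(** * Vector bundles on the projective line *)

HB.instance Definition _ (K : fieldType) :=
  GRing.RMorphism.copy (@of_poly K) (@FracField.tofrac {poly K}).

Section RationalFunctions.
Variable K : fieldType.
Implicit Types (f g : {poly K}) (M : nat).

Lemma of_poly_eq0 f : (of_poly f == 0) = (f == 0).
Proof. exact: tofrac_eq0. Qed.

Lemma of_polyM f g : of_poly (f * g) = of_poly f * of_poly g.
Proof. exact: rmorphM. Qed.

Lemma of_polyD f g : of_poly (f + g) = of_poly f + of_poly g.
Proof. exact: rmorphD. Qed.

Lemma of_polyN f : of_poly (- f) = - of_poly f.
Proof. exact: rmorphN. Qed.

Lemma of_polyB f g : of_poly (f - g) = of_poly f - of_poly g.
Proof. exact: rmorphB. Qed.

Lemma of_polyXn f M : of_poly (f ^+ M) = of_poly f ^+ M.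
Proof. exact: rmorphXn. Qed.

Lemma of_poly1 : of_poly 1 = 1 :> ratfun K.
Proof. exact: rmorph1. Qed.

Lemma tvar_neq0 : tvar K != 0.
Proof. by rewrite of_poly_eq0 polyX_eq0. Qed.

Lemma of_polyX M : of_poly 'X^M = tvar K ^+ M.
Proof. exact: rmorphXn. Qed.

Lemma of_poly_inv_revp f M : (size f <= M.+1)%N ->
  of_poly_inv f = of_poly (revp M f) / tvar K ^+ M.
Proof.
move=> sf; have -> : revp M f = \sum_(i < size f) f`_i *: 'X^(M - i).
  rewrite -[f in LHS]coefK poly_def revp_sum; apply: eq_bigr => i _.
  by rewrite revpZ revpXn // -ltnS (leq_trans _ sf).
rewrite /of_poly_inv /map_poly horner_poly rmorph_sum mulr_suml.
apply: eq_bigr => i _; rewrite -mul_polyC rmorphM /= -mulrA; congr (_ * _).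
have iM : (i <= M)%N by rewrite -ltnS (leq_trans _ sf).
have tM : tvar K ^+ M = tvar K ^+ (M - i) * tvar K ^+ i by rewrite -exprD subnK.
rewrite of_polyX exprVn tM invfM mulrA divff ?mul1r //.
by rewrite expf_neq0 // tvar_neq0.
Qed.

Lemma regoo_of_poly f M : (size f <= M.+1)%N -> regoo (of_poly f / tvar K ^+ M).
Proof.
move=> sf; exists (revp M f).
by rewrite (of_poly_inv_revp (size_revp M f)) revpK.
Qed.

(** The representative n / d chosen by [repr] need not be f / 1, but n = d f holds, and the quotient
    rule then gives f'. *)
Lemma ddt_of_poly f : ddt (of_poly f) = of_poly f^`().
Proof.
have [n [d [En Ed d0 nd]]] : exists n d : {poly K},
    [/\ (frac (repr (of_poly f))).1 = n, (frac (repr (of_poly f))).2 = d,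
        d != 0 & n = d * f].
  exists (frac (repr (of_poly f))).1, (frac (repr (of_poly f))).2; split=> //.
    exact: denom_ratioP.
  have E : of_poly f = (\pi_(ratfun K) (Ratio f 1))%qT by rewrite /of_poly piE.
  have := FracField.equivf_l (Ratio f 1).
  by rewrite !numden_Ratio ?oner_neq0 // mulr1 -E.
rewrite /ddt En Ed nd derivM.
have -> : (d^`() * f + d * f^`()) * d - d * f * d^`() = f^`() * d ^+ 2 by ring.
by rewrite rmorphM mulfK // of_poly_eq0 expf_neq0.
Qed.
End RationalFunctions.

(** * Two by two matrices and the Higgs bundles of M(1,0) *)

Definition mx22 (R : Type) (a b c d : R) : 'M[R]_2 :=
  \matrix_(i, j) if i == ord0 then (if j == ord0 then a else b)
                 else (if j == ord0 then c else d).

Lemma ord2P (P : 'I_2 -> Prop) : P ord0 -> P ord_max -> forall i, P i.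
Proof.
move=> P0 P1 [[|[|]] //= Hi]; first by rewrite (_ : Ordinal Hi = ord0) //; apply: val_inj.
by rewrite (_ : Ordinal Hi = ord_max) //; apply: val_inj.
Qed.

Section Mx22.
Variable R : comUnitRingType.
Implicit Types a b c d : R.

Lemma mx22_eq (A : 'M[R]_2) a b c d :
  A ord0 ord0 = a -> A ord0 ord_max = b -> A ord_max ord0 = c ->
  A ord_max ord_max = d -> A = mx22 a b c d.
Proof.
move=> Ha Hb Hc Hd; apply/matrixP.
by apply: ord2P => //; apply: ord2P; rewrite mxE.
Qed.

Lemma mulmx22 a b c d a' b' c' d' :
  mx22 a b c d *m mx22 a' b' c' d' =
  mx22 (a * a' + b * c') (a * b' + b * d') (c * a' + d * c') (c * b' + d * d').
Proof. by apply: mx22_eq; rewrite !mxE !big_ord_recl big_ord0 !mxE /= addr0. Qed.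

Lemma addmx22 a b c d a' b' c' d' :
  mx22 a b c d + mx22 a' b' c' d' = mx22 (a + a') (b + b') (c + c') (d + d').
Proof. by apply: mx22_eq; rewrite !mxE. Qed.

Lemma scalemx22 k a b c d :
  k *: mx22 a b c d = mx22 (k * a) (k * b) (k * c) (k * d).
Proof. by apply: mx22_eq; rewrite !mxE. Qed.

Lemma mx22_1 : mx22 1 0 0 1 = 1%:M :> 'M[R]_2.
Proof. by apply/esym/mx22_eq; rewrite mxE. Qed.

Lemma mx22_unit (A B : 'M[R]_2) : A *m B = 1%:M -> A \in unitmx /\ invmx A = B.
Proof.
move=> AB; have [uA _] := mulmx1_unit AB; split=> //.
by rewrite -[LHS]mulmx1 -AB mulKmx.
Qed.

End Mx22.

(** Used with A = t^(m-3), B the equation of D, C = s and T = t; stated over an arbitrary field so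
    that [field] meets only variables. *)
Lemma log_form_at_oo (G : fieldType) (A B C T : G) :
  A != 0 -> B != 0 -> T != 0 ->
  B / (A * T ^+ 3) * (T ^+ 2 * (C / B * T)) = C / A.
Proof. by move=> hA hB hT; field; rewrite hA hB hT. Qed.

Section BundlesOnP1.
Variable K : fieldType.
Local Notation t := (tvar K).
Implicit Types (f : ratfun K) (O : ratfun K -> Prop).

Lemma mx_in22 O (a b c d : ratfun K) :
  O a -> O b -> O c -> O d -> mx_in O (mx22 a b c d).
Proof. by move=> Oa Ob Oc Od i j; rewrite mxE; case: ifP; case: ifP. Qed.

Lemma GL_in_inverse O r (A B : 'M[ratfun K]_r) :
  A *m B = 1%:M -> mx_in O A -> mx_in O B -> GL_in O A.
Proof.
move=> AB OA OB; have [uA _] := mulmx1_unit AB; split=> //.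
by rewrite (_ : invmx A = B) // -[LHS]mulmx1 -AB mulKmx.
Qed.

Lemma reg0_of_poly (f : {poly K}) : reg0 (of_poly f).
Proof. by exists f. Qed.

Lemma reg0_0 : reg0 (0 : ratfun K).
Proof. by exists 0; rewrite rmorph0. Qed.

Lemma regoo_of_poly0 (c : K) : regoo (of_poly c%:P).
Proof.
have := @regoo_of_poly K c%:P 0; rewrite expr0 invr1 mulr1; apply.
exact: size_polyC_leq1.
Qed.

Lemma regoo_0 : regoo (0 : ratfun K).
Proof. by have := regoo_of_poly0 0; rewrite rmorph0. Qed.

Lemma regooN f : regoo f -> regoo (- f).
Proof. 
case=> g ->; exists (- g); rewrite (@of_poly_inv_revp K g (size g)) //.
rewrite (@of_poly_inv_revp K (- g) (size g)) ?size_polyN //.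
by rewrite -scaleN1r revpZ scaleN1r rmorphN mulNr.
Qed.

Lemma split_bundle22 (a b : int) :
  split_bundle K (pair2 a b) = mx22 (t ^ (- a)) 0 0 (t ^ (- b)).
Proof. by apply: mx22_eq; rewrite !mxE. Qed.

Lemma split_bundle10V :
  split_bundle K (pair2 1 0) *m mx22 t 0 0 1 = 1%:M.
Proof.
rewrite split_bundle22 oppr0 expr0z mulmx22.
rewrite !(mulr0, mul0r, addr0, add0r, mulr1) -mx22_1.
by rewrite mulVf // tvar_neq0.
Qed.

Lemma is_bundle_split : is_bundle (split_bundle K (pair2 1 0)).
Proof.
apply: (GL_in_inverse split_bundle10V); first rewrite split_bundle22 oppr0 expr0z.
  have r0 : reg0oo (0 : ratfun K) by exists 0, 0%N; rewrite rmorph0 mul0r.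
  have r1 : reg0oo (1 : ratfun K) by exists 1, 0%N; rewrite rmorph1 divr1.
  by apply: mx_in22 => //; exists 1, 1%N; rewrite rmorph1 mul1r.
have r0 : reg0oo (0 : ratfun K) by exists 0, 0%N; rewrite rmorph0 mul0r.
have r1 : reg0oo (1 : ratfun K) by exists 1, 0%N; rewrite rmorph1 divr1.
by apply: mx_in22 => //; exists 'X, 0%N; rewrite divr1.
Qed.

Definition M10_higgs (m : nat) (y : 'I_m -> K * K) (s : {poly K}) : higgs K 2 :=
  Higgs (split_bundle K (pair2 1 0)) (mx22 0 0 (of_poly s / of_poly (div0 y)) 0).

(** The bound on the degree of s is regularity at infinity: there the field times the equation of D
    becomes s / t^(m-3). *)
Lemma M10_coord_higgs m (y : 'I_m -> K * K) (s : {poly K}) (v : 'I_(m - 2) -> K) :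
  (2 < m)%N -> div0 y != 0 -> s != 0 -> (size s <= m - 2)%N ->
  coords_poly v = s -> M10_coord y v (M10_higgs y s).
Proof.
move=> m2 P0 s0 ss vs; split; last by rewrite mxE /= -vs.
have Pr : of_poly (div0 y) != 0 by rewrite of_poly_eq0.
split; first by [].
- split; first exact: is_bundle_split.
  + apply: mx_in22; rewrite /log_form0 ?mulr0; try exact: reg0_0.
    by rewrite mulrCA mulfV // mulr1; apply: reg0_of_poly.
  + rewrite /= (mx22_unit split_bundle10V).2 split_bundle22 !mulmx22.
    rewrite !(mulr0, mul0r, addr0, add0r) oppr0 expr0z mul1r.
    apply: mx_in22; rewrite /log_formoo ?mulr0; try exact: regoo_0.
    rewrite (of_poly_inv_revp (size_divoo y)) revp_divoo.
    have -> : of_poly (div0 y) / t ^+ m *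
        (t ^+ 2 * (of_poly s / of_poly (div0 y) * t)) = of_poly s / t ^+ (m - 3).
      have -> : t ^+ m = t ^+ (m - 3) * t ^+ 3 by rewrite -exprD subnK.
      apply: log_form_at_oo; first exact: (expf_neq0 _ (tvar_neq0 K)).
        exact: Pr.
      exact: tvar_neq0.
    by apply: regoo_of_poly; apply: leq_trans ss _; lia.
- apply: ord2P; apply: ord2P => h; rewrite ?mxE //=.
rewrite mxE /=; apply: mulf_neq0; last by rewrite invr_eq0.
by rewrite of_poly_eq0.
Qed.

End BundlesOnP1.

(** The matrix has square zero, so the exponential stops after its linear term, which is present
    because p > 1. *)
Lemma expmx22 (F : fieldType) (p : nat) (f : F) : (1 < p)%N ->
  expmx p (mx22 0 0 f 0) = mx22 1 0 f 1.
Proof.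
case: p => [|[|p]] // _; rewrite /expmx !big_ord_recl big1 => [|i _].
  rewrite /= expr0 expr1 addr0 fact0 factS fact0 muln1 invr1 !scale1r.
  by rewrite -[1](mx22_1 F) addmx22 !(addr0, add0r).
have -> : lift ord0 (lift ord0 i) = i.+2 :> nat by [].
rewrite !exprS mulrA; have -> : mx22 0 0 f 0 * mx22 0 0 f 0 = 0.
  by rewrite [LHS]mulmx22 !(mulr0, mul0r, addr0); apply/esym/mx22_eq; rewrite mxE.
by rewrite mul0r scaler0.
Qed.

(** * The splitting of the inverse Cartier transform *)

Section FieldIdentities.
Variable G : fieldType.

Lemma frac_cancel (A B C T : G) : A != 0 -> A * B / T * (C / A) = B * C / T.
Proof.
move=> A0; have E (a t : G) : A * B * t * (C * a) = A * a * (B * C * t) by ring.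
by rewrite E mulfV // mul1r.
Qed.

Lemma frac_add (A B C T : G) : T != 0 -> A + B * (C / T) = (T * A + B * C) / T.
Proof. by move=> T0; field. Qed.

Lemma frac_shift (A u v : G) : v != 0 -> A / u = A / (u * v) * v.
Proof. by move=> v0; rewrite invfM mulrA divfK. Qed.

Lemma frac_twist (u v : G) : v != 0 -> u ^- 1 = v / (u * v).
Proof. by move=> v0; rewrite expr1 invfM mulrCA mulfV // mulr1. Qed.

Lemma frame_inverse (A B C D : G) : A * D - B * C = 1 ->
  mx22 D (- C) (- B) A *m mx22 A C B D = 1%:M.
Proof. by move=> det1; rewrite mulmx22 -mx22_1; congr mx22; rewrite -?det1; ring. Qed.

Lemma frame_oo_inverse (A B C D f u v : G) : u != 0 -> v != 0 ->
  A * D - B * C = 1 ->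
  mx22 ((D + f * C) * v) (- (C / u)) (- ((B + f * A) * u)) (A / v) *m
  mx22 (A / v) (C / u) ((B + f * A) * u) ((D + f * C) * v) = 1%:M.
Proof.
move=> u0 v0 det1; rewrite mulmx22 -mx22_1.
congr mx22; rewrite -?det1; field; by rewrite ?u0 ?v0.
Qed.

Lemma frame_transition (A B C D f u v : G) : u != 0 -> v != 0 ->
  mx22 u^-1 0 0 v^-1 *m mx22 D (- C) (- B) A =
  mx22 ((D + f * C) * v) (- (C / u)) (- ((B + f * A) * u)) (A / v) *m
  mx22 (u * v)^-1 0 f 1.
Proof.
by move=> u0 v0; rewrite !mulmx22; congr mx22; field; rewrite ?u0 ?v0.
Qed.

(** Lower left entry of the gauge transform B N B^-1 - B' B^-1 for a frame change B of determinant
    1; primed letters will be derivatives. *)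
Lemma gr_entry (A B C D A' B' C' D' b : G) :
  ((mx22 D (- C) (- B) A *m mx22 0 0 b 0 - mx22 D' (- C') (- B') A')
     *m mx22 A C B D) ord_max ord0 = A ^+ 2 * b + (A * B' - A' * B).
Proof.
rewrite mulmx22 -[- mx22 _ _ _ _]scaleN1r scalemx22 addmx22 mulmx22 mxE /=; ring.
Qed.

Lemma gr_entry_frac (P Q E S A w : G) : P != 0 -> Q != 0 ->
  A ^+ 2 * (Q * E * (S / (P * Q))) + w = (P * w + A ^+ 2 * E * S) / P.
Proof. by move=> P0 Q0; field; rewrite P0 Q0. Qed.

End FieldIdentities.

Section FlowStepOfSplitting.
Variables (K : fieldType) (p m : nat) (y : 'I_m -> K * K).
Variables (c0 coo : {poly K}) (N : nat) (e q : {poly K}).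
Local Notation P := (div0 y).
Hypothesis char_K : p \in [pchar K].
Hypothesis p_odd : odd p.
Hypothesis P_neq0 : P != 0.
Hypothesis FD : frobenius_data p m P c0 coo N e q.
Local Notation r := (p.-1./2).
Local Notation t := (tvar K).

Lemma of_poly_div_eq M (b w F a : {poly K}) : 'X^M * b = w - F * a ->
  of_poly b = of_poly w / t ^+ M - of_poly F / t ^+ M * of_poly a.
Proof.
move=> E; have tM : t ^+ M != 0 by rewrite expf_neq0 // tvar_neq0.
apply: (mulfI tM); rewrite -[in LHS]of_polyX -of_polyM E of_polyB of_polyM.
by rewrite mulrBr mulrCA mulfV // mulr1 mulrA [_ * (_ / _)]mulrCA mulfV // mulr1.
Qed.

(** The columns (al, be) and (ga, de) form a frame of V over U_0 of determinant 1. The bounds on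
    [al] and [w], resp. on [ga] and [w2], let them extend to maps O(r + 1) -> V, resp. O(r) -> V,
    and together these give the splitting. *)
Lemma flow_step_of_splitting (s al be ga de w w2 : {poly K}) :
  (size al <= r.+1)%N -> (size w <= (N - r.+1).+1)%N ->
  (size ga <= r.+2)%N -> (size w2 <= (N - r).+1)%N ->
  'X^N * be = w - q * s ^+ p * al -> 'X^N * de = w2 - q * s ^+ p * ga ->
  al * de - be * ga = 1 ->
  flow_step p (corr0 c0) (corroo p coo) (M10_higgs y s)
    (M10_higgs y (P * (al * be^`() - al^`() * be) + al ^+ 2 * e * s ^+ p)).
Proof.
move=> sal sw sga sw2 Ebe Ede det1.
have p1 : (1 < p)%N by rewrite prime_gt1 ?(pcharf_prime char_K).
have pE : p = (r.+1 + r)%N by rewrite {1}(half_p p_odd) -addnn addSn.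
have rN : (2 * r <= N)%N.
  by apply: leq_trans (fd_leN FD); rewrite mul2n {2}(half_p p_odd); apply: leqnSn.
have rN' : (r < N)%N by apply: leq_trans (fd_leN FD); rewrite {2}pE addSn ltnS leq_addr.
have tn k : t ^+ k != 0 by rewrite expf_neq0 // tvar_neq0.
have Pr : of_poly P != 0 by rewrite of_poly_eq0.
(* [fr] represents the class of V as an extension of O(p) by O. *)
pose a := of_poly s / of_poly P; pose fr := of_poly (q * s ^+ p) / t ^+ N.
have Ebe' : of_poly be = of_poly w / t ^+ N - fr * of_poly al.
  exact: of_poly_div_eq.
have Ede' : of_poly de = of_poly w2 / t ^+ N - fr * of_poly ga.
  exact: of_poly_div_eq.
have Edet : of_poly al * of_poly de - of_poly be * of_poly ga = 1.
  by rewrite -!of_polyM -of_polyB det1 of_poly1.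
have Efr : (corr0 c0 - corroo p coo) * a ^+ p = fr.
  rewrite /corr0 /corroo (of_poly_inv_revp (fd_coo FD)) opprK /a expr_div_n.
  have -> : of_poly c0 + t ^+ (2 * p) * (of_poly (revp N coo) / t ^+ N) =
      of_poly (P ^+ p * q) / t ^+ N.
    have Eq : of_poly 'X^N * of_poly c0 + of_poly 'X^(2 * p) * of_poly (revp N coo)
        = of_poly (P ^+ p * q) by rewrite -!of_polyM -of_polyD (fd_q FD).
    by rewrite -Eq !of_polyX; exact: frac_add (tn N).
  have -> : of_poly (P ^+ p * q) = of_poly P ^+ p * of_poly q.
    by rewrite of_polyM of_polyXn.
  rewrite /fr; have -> : of_poly (q * s ^+ p) = of_poly q * of_poly s ^+ p.
    by rewrite of_polyM of_polyXn.
  have Pp : of_poly P ^+ p != 0 by exact: expf_neq0.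
  move: (of_poly P ^+ p) (of_poly q) (of_poly s ^+ p) (t ^+ N) Pp => A B C T A0.
  exact: frac_cancel.
pose b := (t ^+ p.-1 + ddt (corr0 c0)) * a ^+ p.
have Eb : b = of_poly (P ^+ p.-1 * e) * a ^+ p.
  by rewrite /b /corr0 ddt_of_poly -of_polyX -of_polyD (fd_e FD).
have EC : inv_cartier p (corr0 c0) (corroo p coo) (M10_higgs y s) =
    Conn (mx22 (t ^- p) 0 fr 1) (mx22 0 0 b 0).
  have z0 : 0 ^+ p = 0 :> ratfun K by rewrite expr0n; case: (p) p1.
  have EN : frobmx p (mx22 0 0 a 0) = mx22 0 0 (a ^+ p) 0.
    by apply: mx22_eq; rewrite !mxE /= ?z0.
  rewrite /inv_cartier /M10_higgs /= -/a EN !scalemx22 !mulr0 -/b Efr.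
  congr Conn; rewrite expmx22 // split_bundle22 oppr0 expr0z.
  have -> : frobmx p (mx22 (t ^ (-1)) 0 0 1) = mx22 (t ^- p) 0 0 1.
    by apply: mx22_eq; rewrite !mxE /= ?z0 ?expr1n // exprVn.
  by rewrite mulmx22 !(mulr0, mul0r, addr0, add0r, mulr1, mul1r).
pose C0 := mx22 (of_poly al) (of_poly ga) (of_poly be) (of_poly de).
pose B0 := mx22 (of_poly de) (- of_poly ga) (- of_poly be) (of_poly al).
have BC : B0 *m C0 = 1%:M.
  exact: frame_inverse.
have CB : C0 *m B0 = 1%:M by apply: mulmx1C.
(* The gauge transform of the connection by [B0], the only choice that makes [B0] horizontal. *)
pose A := (B0 *m mx22 0 0 b 0 - map_mx (@ddt K) B0) *m C0.
pose V := Conn (split_bundle K (pair2 (p.+1./2)%:Z (p.-1./2)%:Z)) A.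
have half1 : p.+1./2 = r.+1 by rewrite {1}pE; lia.
exists V; split; first by [].
- rewrite EC.
  (* The same change of frame read on U_oo; its entries are regular there by the four degree bounds,
     and [Coo] is its inverse. *)
  pose Boo := mx22 (of_poly w2 / t ^+ (N - r)) (- (of_poly ga / t ^+ r.+1))
                   (- (of_poly w / t ^+ (N - r.+1))) (of_poly al / t ^+ r).
  pose Coo := mx22 (of_poly al / t ^+ r) (of_poly ga / t ^+ r.+1)
                   (of_poly w / t ^+ (N - r.+1)) (of_poly w2 / t ^+ (N - r)).
  have tN1 : t ^+ N = t ^+ (N - r) * t ^+ r by rewrite -exprD subnK //; lia.
  have tN2 : t ^+ N = t ^+ (N - r.+1) * t ^+ r.+1 by rewrite -exprD subnK //; lia.
  have Ew2 : of_poly w2 / t ^+ (N - r) = (of_poly de + fr * of_poly ga) * t ^+ r.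
    by rewrite Ede' subrK tN1; exact: frac_shift (tn _).
  have Ew : of_poly w / t ^+ (N - r.+1) = (of_poly be + fr * of_poly al) * t ^+ r.+1.
    by rewrite Ebe' subrK tN2; exact: frac_shift (tn _).
  exists B0, Boo; split; last first.
    by rewrite /V /A /= -mulmxA CB mulmx1 addrC subrK.
  split.
  + apply: (GL_in_inverse BC); apply: mx_in22; rewrite -?of_polyN;
      exact: reg0_of_poly.
  + apply: (@GL_in_inverse _ _ _ _ Coo).
    * by rewrite /Boo /Coo Ew2 Ew; exact: (frame_oo_inverse fr (tn r.+1) (tn r) Edet).
    * by apply: mx_in22; try apply: regooN; apply: regoo_of_poly.
    * by apply: mx_in22; apply: regoo_of_poly.
  change (split_bundle K (pair2 (p.+1./2)%:Z r%:Z) *m B0 =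
          Boo *m mx22 (t ^- p) 0 fr 1).
  rewrite split_bundle22 half1 /Boo Ew2 Ew -!exprnN.
  have -> : t ^+ p = t ^+ r.+1 * t ^+ r by rewrite -exprD -pE.
  exact: (frame_transition _ _ _ _ fr (tn r.+1) (tn r)).
(* Twisting by O(-r) turns the transition matrix diag(t^-(r+1), t^-r) into diag(t^-1, 1), so the
   identity is an isomorphism. *)
exists 1%:M, 1%:M; split.
  have G O : O 0 -> O 1 -> GL_in O (1%:M : 'M[ratfun K]_2).
    move=> O0 O1; apply: (@GL_in_inverse _ _ _ _ 1%:M); first by rewrite mulmx1.
      by rewrite -mx22_1; apply: mx_in22.
    by rewrite -mx22_1; apply: mx_in22.
  split.
  + by apply: G; [exact: reg0_0 | exists 1; rewrite rmorph1].
  + apply: G; first exact: regoo_0.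
    by have := regoo_of_poly0 (1 : K); rewrite rmorph1.
  change (split_bundle K (pair2 1 0) *m 1%:M =
    1%:M *m (t ^ (- - r%:Z) *: split_bundle K (pair2 (p.+1./2)%:Z r%:Z))).
  rewrite mulmx1 mul1mx opprK half1 !split_bundle22 scalemx22 oppr0 expr0z.
  rewrite !mulr0 -!exprnN -exprnP [t ^+ r.+1]exprS; congr mx22.
    exact: frac_twist (tn r).
  exact: esym (mulfV (tn r)).
rewrite mulmx1 mul1mx /=.
have -> : A ord_max ord0 =
    of_poly (P * (al * be^`() - al^`() * be) + al ^+ 2 * e * s ^+ p) / of_poly P.
  rewrite /A; have -> : map_mx (@ddt K) B0 = mx22 (of_poly de^`()) (- of_poly ga^`())
      (- of_poly be^`()) (of_poly al^`()).
    by apply: mx22_eq; rewrite !mxE /= -?of_polyN ddt_of_poly ?derivN.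
  rewrite gr_entry Eb /a of_polyD !of_polyM of_polyB !of_polyM !of_polyXn expr_div_n.
  have -> : of_poly P ^+ p = of_poly P * of_poly P ^+ p.-1.
    by rewrite -exprS prednK // ltnW.
  exact: gr_entry_frac Pr (expf_neq0 _ Pr).
by apply/esym/mx22_eq; rewrite !mxE /= ?mulr0 ?mulr1.
Qed.

End FlowStepOfSplitting.

(** * Completing the map O(r + 1) -> V to a splitting of V *)

Section FlowStep.
Variables (K : closedFieldType) (p m : nat) (y : 'I_m -> K * K).
Variables (c0 coo : {poly K}) (N : nat) (e q : {poly K}).
Local Notation P := (div0 y).
Hypothesis char_K : p \in [pchar K].
Hypothesis p_odd : odd p.
Hypothesis P_neq0 : P != 0.
Hypothesis FD : frobenius_data p m P c0 coo N e q.
Local Notation r := (p.-1./2).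
Local Notation t := (tvar K).
Variables (s : {poly K}) (z : K).
Hypothesis det_neq0 : \det (hankel r N (q * s ^+ p) z) != 0.

Local Notation F := (q * s ^+ p).
Local Notation al := (hodge_denom p N q s).
Local Notation be := (second_coord p N q s al).
Local Notation w := (second_coord_oo p N q s al).

(* (ga, de) generates, together with the section (al, be) of O(r + 1), the
   frame of O(r + 1) + O(r).  The determinant al de - be ga is constant by its
   degree, hence equal to its value at z, where ga vanishes. *)
Lemma split_complement : exists ga de w2 : {poly K},
  [/\ (size ga <= r.+2)%N, (size w2 <= (N - r).+1)%N,
      'X^N * de = w2 - F * ga & al * de - be * ga = 1].
Proof.
have rN : (2 * r <= N)%N by exact: (double_half_le p_odd FD).
have r0 : (0 < r)%N by exact: (half_p_gt0 char_K p_odd).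
have alz : al.[z] != 0 by rewrite /hodge_denom pade_denomE.
(* The geometric progression makes the coefficients of X^(N-i) in (X - z) F g cancel for 0 < i < r,
   and its first term makes de(z) = 1 / al(z). *)
have [g [sg gz Hg]] :=
  hankel_solve rN (fun i => - (z ^+ i.-1 / al.[z])) det_neq0.
pose ga := ('X - z%:P) * g; pose w2 := take_poly N (F * ga).
pose de := - drop_poly N (F * ga).
have Ede : 'X^N * de = w2 - F * ga.
  by rewrite /w2 /de -[X in _ = _ - X](poly_take_drop N); ring.
have EF : F * ga = 'X * (F * g) - z *: (F * g).
  by rewrite -mul_polyC /ga; move: F => F'; ring.
have N0 : (0 < N)%N by apply: leq_trans rN; rewrite muln_gt0.
have sw2 : (size w2 <= N - r.-1)%N.
  apply/size_take_polyP; first by lia.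
  move=> i /andP[i0 ir]; rewrite EF coefB coefXM coefZ ifN; last by lia.
  rewrite (_ : (N - i).-1 = (N - i.+1)%N); last by lia.
  rewrite !Hg; try lia.
  by case: i i0 {ir} => // i _ /=; rewrite exprS; ring.
have dez : de.[z] = al.[z]^-1.
  pose d := drop_poly N (F * g).
  have -> : de = - (((F * g)`_(N.-1))%:P + ('X - z%:P) * d).
    congr (- _); apply/polyP => i; rewrite coef_drop_poly EF mulrBl.
    rewrite !(coefD, coefN, coefC, coefXM, coefZ, coefCM) /d !coef_drop_poly.
    case: i => [|i] /=; first by rewrite add0n (gtn_eqF N0) sub0r.
    by rewrite add0r addSnnS.
  rewrite !hornerE subrr mul0r addr0 -subn1 Hg; last by lia.
  by rewrite opprK expr0 mul1r.
have Ebe := second_coordE p N q s al.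
have Edet : 'X^N * (al * de - be * ga) = al * w2 - w * ga.
  have -> : 'X^N * (al * de - be * ga) = al * ('X^N * de) - ('X^N * be) * ga by ring.
  by rewrite Ede Ebe; move: F => F'; ring.
have sal : (size al <= r.+1)%N by exact: size_pade_denom.
have sw : (size w <= (N - r.+1).+1)%N.
  by rewrite subnSK; [exact: size_take_pade_denom | lia].
have sga : (size ga <= (1 + r).+1)%N.
  by apply: size_polyM_le => //; rewrite size_XsubC.
have sw2' : (size w2 <= (N - r).+1)%N by apply: leq_trans sw2 _; lia.
(* X^N times the determinant is al w2 - w ga, where both products have degree at most N. *)
have sdet : (size (al * de - be * ga)%R <= 1)%N.
  have [->|d0] := eqVneq (al * de - be * ga) 0; first by rewrite size_poly0.
  rewrite -(leq_add2l N) -size_mulXn // mulrC Edet addn1.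
  apply: leq_trans (size_polyD _ _) _; rewrite geq_max size_polyN.
  have := size_polyM_le sal sw2'; have := size_polyM_le sw sga.
  move: (size _) (size _) => u v; lia.
exists ga, de, w2; split=> //.
rewrite (size1_polyC sdet); congr (_%:P).
have := congr1 (horner^~ z) (size1_polyC sdet); rewrite hornerC => <-.
have gaz : ga.[z] = 0 by rewrite hornerM hornerXsubC subrr mul0r.
by rewrite hornerD hornerN (hornerM al) (hornerM be) gaz mulr0 subr0 dez divff.
Qed.

Lemma flow_step_gr_field :
  flow_step p (corr0 c0) (corroo p coo) (M10_higgs y s)
    (M10_higgs y (gr_field p P N e q s al)).
Proof.
have [ga [de [w2 [sga sw2 Ede det1]]]] := split_complement.
have rN : (2 * r <= N)%N by exact: (double_half_le p_odd FD).
have r0 : (0 < r)%N by exact: (half_p_gt0 char_K p_odd).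
apply: (flow_step_of_splitting char_K p_odd P_neq0 FD
  (w := w) (ga := ga) (de := de) (w2 := w2)) => //.
- exact: size_pade_denom.
- by rewrite subnSK; [exact: size_take_pade_denom | lia].
- exact: second_coordE.
Qed.

End FlowStep.

(** * Dominance *)

Lemma comp_map_divoo (R S : comNzRingType) (f : {rmorphism R -> S}) (n m : nat)
    (x : 'I_m -> R * R) :
  map_poly f (divoo x) \Po 'X^n = \prod_i ((f (x i).2)%:P - f (x i).1 *: 'X^n).
Proof.
rewrite rmorph_prod rmorph_prod; apply: eq_bigr => i _ /=.
rewrite rmorphB /= map_polyC map_polyZ map_polyX comp_polyB comp_polyC.
by rewrite comp_polyZ comp_polyX.
Qed.

Lemma comp_map_div0 (R S : comNzRingType) (f : {rmorphism R -> S}) (n m : nat)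
    (x : 'I_m -> R * R) :
  map_poly f (div0 x) \Po 'X^n = \prod_i (f (x i).2 *: 'X^n - (f (x i).1)%:P).
Proof.
rewrite rmorph_prod rmorph_prod; apply: eq_bigr => i _ /=.
rewrite rmorphB /= map_polyC map_polyZ map_polyX comp_polyB comp_polyC.
by rewrite comp_polyZ comp_polyX.
Qed.

(** With f = sigma and n = p, this identifies the reversal of the [d] attached to U_oo with the one
    attached to U_0. *)
Lemma revp_comp_map_divoo (R S : comNzRingType) (f : {rmorphism R -> S})
    (n m : nat) (x : 'I_m -> R * R) :
  revp (n * m) (map_poly f (divoo x) \Po 'X^n) = map_poly f (div0 x) \Po 'X^n.
Proof.
rewrite comp_map_divoo comp_map_div0 mulnC revp_prod => [|i].
  by apply: eq_bigr => i _; rewrite revp_lin.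
apply: leq_trans (size_polyD _ _) _; rewrite geq_max size_polyN.
rewrite (leq_trans (size_polyC_leq1 _)) // (leq_trans (size_scale_leq _ _)) //.
by rewrite size_polyXn.
Qed.

Lemma size_comp_map_divoo (R S : comNzRingType) (f : {rmorphism R -> S})
    (n m : nat) (x : 'I_m -> R * R) :
  (size (map_poly f (divoo x) \Po 'X^n) <= (n * m).+1)%N.
Proof.
rewrite comp_map_divoo mulnC; apply: size_prod_le => i.
apply: leq_trans (size_polyD _ _) _; rewrite geq_max size_polyN.
rewrite (leq_trans (size_polyC_leq1 _)) // (leq_trans (size_scale_leq _ _)) //.
by rewrite size_polyXn.
Qed.

(** At most one of the distinct points is at infinity; one index is deleted and the first m - 2
    remaining ones are kept. *)
Lemma finite_points (K : fieldType) (m : nat) (y : 'I_m -> K * K) :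
  (1 < m)%N -> distinct_points y ->
  exists h : 'I_(m - 2) -> 'I_m, injective h /\ forall i, (y (h i)).2 != 0.
Proof.
move=> m1 yd; have [i0 Hi0] : exists i0 : 'I_m, forall j, j != i0 -> (y j).2 != 0.
  have [/existsP[i0 /eqP b0]|/existsPn h] := boolP [exists i, (y i).2 == 0].
    exists i0 => j ji; apply: contraNneq (yd _ _ ji) => bj.
    by rewrite b0 bj !mulr0.
  by exists (Ordinal m1).
have le : (m - 2 <= m.-1)%N by lia.
exists (fun i => lift i0 (widen_ord le i)); split=> [i j /lift_inj e|i].
  exact/val_inj/(congr1 val e).
by apply: Hi0; rewrite eq_sym neq_lift.
Qed.

Lemma flow_map_dominant (K : closedFieldType) (p m : nat) (y : 'I_m -> K * K)
    (c0 coo : {poly K}) (N : nat) (e q : {poly K}) :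
  p \in [pchar K] -> odd p -> (3 < m)%N -> distinct_points y ->
  frobenius_data p m (div0 y) c0 coo N e q ->
  dominant (flow_map p y c0 coo).
Proof.
move=> char_K p_odd m3 yd FD d1 d2 g f _ g0 _ f0.
have m1 : (1 < m)%N by lia.
have m2 : (2 < m)%N by lia.
have P0 : div0 y != 0 by exact: div0_neq0.
have sP := size_div0 y.
have [h [h_inj hb]] := finite_points m1 yd.
pose z i := (y (h i)).1 / (y (h i)).2.
have z_root i : root (div0 y) (z i).
  by apply/root_div0P; exists (h i); rewrite mulrC divfK.
have z_inj : injective z.
  move=> i j zij; apply/eqP; apply: contraT => ij.
  have hij : h i != h j by rewrite (inj_eq h_inj).
  have /eqP[] := yd _ _ hij.
  by rewrite -[(y (h i)).1](divfK (hb i)) -/(z i) zij mulrAC divfK // mulrC.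
have [v [i [gv det fv]]] := generic_point char_K p_odd m3 sP FD z_inj z_root f0 g0.
pose s := coords_poly v; pose s' := gr_field p (div0 y) N e q s (hodge_denom p N q s).
have s0 : s != 0 by exact: (det_hankel0_neq0 char_K p_odd FD det).
have al0 : hodge_denom p N q s != 0.
  apply: contraNneq det => a0.
  by rewrite -pade_denomE -[pade_denom _ _ _]/(hodge_denom p N q s) a0 horner0.
have ss : (size s <= m - 2)%N by exact: size_coords_poly.
have ss' : (size s' <= m - 2)%N.
  apply: (size_gr_field char_K p_odd m2 sP FD ss (size_pade_denom _ _ _)).
  exact: size_take_pade_denom (double_half_le p_odd FD) _.
have s'0 : s' != 0 by exact: (gr_field_neq0 char_K p_odd FD s0 al0).
exists v, (fun k => s'`_k); split; [|exact: gv|exact: fv].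
exists (M10_higgs y s), (M10_higgs y s'); split.
- exact: M10_coord_higgs.
- by apply: M10_coord_higgs => //; apply: coords_polyK.
exact: (flow_step_gr_field char_K p_odd P0 FD det).
Qed.

Theorem lemma5p3
  (p : nat) (p_prime : prime p) (p_odd : odd p)
  (k : finFieldType) (char_k : p \in [pchar k])
  (W : comNzRingType) (red : {rmorphism W -> k}) (sigma : {rmorphism W -> W})
  (witt : is_witt_ring p red sigma)
  (m : nat) (m_ge4 : (4 <= m)%N)
  (x : 'I_m -> W * W)
  (x_point : forall i, is_point (x i))
  (x_distinct : distinct_mod_p red x)
  (c0 coo : {poly W})
  (lift0 : log_frob_lift p sigma (div0 x) c0)
  (liftoo : log_frob_lift p sigma (divoo x) coo)
  (K : closedFieldType) (iota : {rmorphism k -> K}) :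
  dominant (flow_map p (map_point (iota \o red) x)
              (map_poly (iota \o red) c0) (map_poly (iota \o red) coo)).
Proof.
pose rho : {rmorphism W -> K} := iota \o red.
pose y := map_point rho x.
have char_K : p \in [pchar K] by rewrite (fmorph_pchar iota).
have m1 : (1 < m)%N by lia.
have y_distinct : distinct_points y.
  move=> i j ij; have := x_distinct i j ij.
  by rewrite /y /map_point /= -!rmorphM; apply: contraNneq => /fmorph_inj ->.
have rho_ker u : rho u = 0 -> exists v, u = p%:R * v.
  move=> /= /eqP; rewrite fmorph_eq0 => /eqP /(witt_ker witt)[v].
  by rewrite subr0 expr1; exists v.
have rho_frob u : rho (sigma u) = rho u ^+ p.
  by rewrite /= (witt_frob witt) rmorphXn.
have tf := witt_torsionfree witt.
have div0y : map_poly rho (div0 x) = div0 y.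
  rewrite rmorph_prod; apply: eq_bigr => i _.
  by rewrite rmorphB /= map_polyZ map_polyX map_polyC.
have divooy : map_poly rho (divoo x) = divoo y.
  rewrite rmorph_prod; apply: eq_bigr => i _.
  by rewrite rmorphB /= map_polyZ map_polyX map_polyC.
have P0 : div0 y != 0 by exact: div0_neq0.
have Q0 : divoo y != 0.
  by apply: contraNneq P0 => Q0; rewrite -revp_divoo Q0 revp0.
have [|d0 [w0 [Hd0 H0 H0']]] :=
  log_frob_lift_reduction char_K rho_ker tf rho_frob lift0; first by rewrite div0y.
have [|doo [woo [Hdoo Hoo Hoo']]] :=
  log_frob_lift_reduction char_K rho_ker tf rho_frob liftoo; first by rewrite divooy.
(* The bound holds for p doo, a difference of two polynomials of degree at most p m, and passes to
   [doo] because W has no p-torsion. *)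
have sdoo : (size doo <= (p * m).+1)%N.
  apply/leq_sizeP => j pmj; apply: tf.
  have := congr1 (fun h : {poly W} => h`_j) Hdoo; rewrite coefCM coefB => ->.
  rewrite !nth_default ?subrr //; first exact: leq_trans (size_comp_map_divoo _ _ _) pmj.
  by apply: leq_trans pmj; apply/size_polyX_le/size_divoo.
have rdoo : revp (p * m) doo = d0.
  apply: (scalep_inj tf); rewrite -revpZ -!mul_polyC Hd0 Hdoo revpB.
  by rewrite (revpX _ (size_divoo x)) revp_divoo revp_comp_map_divoo.
rewrite div0y in H0 H0'; rewrite divooy in Hoo Hoo'.
have [||N [e [q FD]]] := frobenius_data_exists char_K m1 P0 Q0
  (coprimep_div0_deriv m1 y_distinct) (coprimep_divoo_deriv m1 y_distinct)
  (size_divoo y) (revp_divoo y) (doo := map_poly rho doo) (d0 := map_poly rho d0)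
  _ _ (conj H0 H0') (conj Hoo Hoo').
- by apply: leq_trans (size_poly _ _) sdoo.
- by rewrite -map_revp rdoo.
exact: (flow_map_dominant char_K p_odd m_ge4 y_distinct FD).
Qed.
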